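(* For every $p>8$ there are constants $\delta_1=\delta_1(p)>0$ and $A=A(p)\ge 0$ such that the following holds. For every $E>0$ and every closed, compact and connected Lipschitz surface $\Sigma\subset\mathbb{R}^3$ with $\mathcal{M}_p(\Sigma)\le E$, the tangent plane $T_x\Sigma$ is defined at every $x\in\Sigma$ and depends continuously on $x$; more precisely $$\angle(T_x\Sigma,T_y\Sigma)\ \le\ A\,E^{\frac{1}{p+16}}\,|x-y|^{\frac{p-8}{p+16}}$$ for all $x,y\in\Sigma$ with $|x-y|\le\delta_1(p)\,E^{-1/(p-8)}$.
   Context: A closed, compact and connected Lipschitz surface is a compact connected set $\Sigma\subset\mathbb{R}^3$ with $\Sigma=\partial U$ for some bounded domain $U\subset\mathbb{R}^3$, such that near each of its points $\Sigma$ is, after a rigid motion, the graph of a Lipschitz function of two variables. The tangent plane $T_x\Sigma$ of $\Sigma$ at $x$ is the (unique) two-dimensional linear subspace of $\mathbb{R}^3$ with $\operatorname{dist}(x',x+T_x\Sigma)/|x'-x|\to0$ as $x'\to x$, $x'\in\Sigma\setminus\{x\}$ (when it exists). $\angle(P,Q)\in[0,\pi/2]$ denotes the angle between two planes. For a tetrahedron $T=(x_0,x_1,x_2,x_3)\in(\mathbb{R}^3)^4$ put $\mathcal{K}(T)=\dfrac{V(T)}{A(T)(\operatorname{diam}T)^2}$ if the four vertices are not co-planar, and $\mathcal{K}(T)=0$ otherwise, where $V(T)$ is the volume of $T$ and $A(T)$ is the sum of the areas of its four triangular faces. The integral Menger curvature is $\mathcal{M}_p(\Sigma)=\int_{\Sigma}\int_\Sigma\int_\Sigma\int_\Sigma\mathcal{K}^p(x_0,x_1,x_2,x_3)\,d\mathcal{H}^2(x_0)\,d\mathcal{H}^2(x_1)\,d\mathcal{H}^2(x_2)\,d\mathcal{H}^2(x_3)$,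 with $\mathcal{H}^2$ the two-dimensional Hausdorff measure. *)

(* Defs.v *)
From HB Require Import structures.
From mathcomp Require Import all_boot all_order all_algebra.
From mathcomp Require Import all_classical all_reals all_analysis.

Set Implicit Arguments.
Unset Strict Implicit.
Unset Printing Implicit Defensive.

Import Order.TTheory GRing.Theory Num.Theory.
Import numFieldNormedType.Exports.

Local Open Scope classical_set_scope.
Local Open Scope ring_scope.

(* R^3 is 'rV[R]_3, whose library norm is the max norm: it induces the usual
   topology and the usual bounded sets, but all metric quantities below are
   stated with the Euclidean norm [enorm]. *)
Section euclidean.
Context {R : realType}.
Implicit Types (u v w x y : 'rV[R]_3) (P Q : {vspace 'rV[R]_3}).

Definition dotp u v : R := \sum_i u 0 i * v 0 i.

Definition enorm u : R := Num.sqrt (dotp u u).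

Definition dist_plane y x P : R :=
  inf [set enorm (y - (x + v)) | v in [set v | v \in P]].

Definition unit_normal P : 'rV[R]_3 :=
  xget 0 [set n | enorm n = 1 /\ forall v, v \in P -> dotp n v = 0].

(* For \dim P = \dim Q = 2 the unit normals are unique up to sign, so that the
   absolute value makes this independent of the choice in [unit_normal]. *)
Definition plane_angle P Q : R :=
  acos `|dotp (unit_normal P) (unit_normal Q)|.

End euclidean.

Section lipschitz_surface.
Context {R : realType}.

Definition boundary (U : set 'rV[R]_3) : set 'rV[R]_3 :=
  closure U `\` interior U.

Definition bounded_domain (U : set 'rV[R]_3) : Prop :=
  [/\ open U, connected U, U !=set0 & bounded_set U].

(* The isometry y |-> y *m Q + b maps S near x onto the graph
   z_2 = g (z_0, z_1). *)
Definition locally_lipschitz_graph (S : set 'rV[R]_3) (x : 'rV[R]_3) : Prop :=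
  exists (Q : 'M[R]_3) (b : 'rV[R]_3) (g : R * R -> R),
    [/\ Q *m Q^T = 1%:M,
        lipschitz (g : (R^o * R^o)%type -> R^o) &
        \forall y \near x, S y <->
          let z := y *m Q + b in z 0 2%:R = g (z 0 0, z 0 1)].

Definition lipschitz_surface (S : set 'rV[R]_3) : Prop :=
  [/\ compact S, connected S,
      exists2 U, bounded_domain U & S = boundary U &
      forall x, S x -> locally_lipschitz_graph S x].

Definition approximating_plane (S : set 'rV[R]_3) (x : 'rV[R]_3)
    (P : {vspace 'rV[R]_3}) : Prop :=
  \dim P = 2%N /\
  dist_plane y x P / enorm (y - x) @[y --> within (S `\ x) (nbhs x)] --> (0 : R).

Definition has_tangent_plane (S : set 'rV[R]_3) (x : 'rV[R]_3) : Prop :=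
  exists! P, approximating_plane S x P.

(* Meaningful only under [has_tangent_plane S x]. *)
Definition tangent_plane (S : set 'rV[R]_3) (x : 'rV[R]_3) :
    {vspace 'rV[R]_3} :=
  xget 0%VS [set P | approximating_plane S x P].

End lipschitz_surface.

Section hausdorff.
Context {R : realType}.
Implicit Types A : set 'rV[R]_3.
Local Open Scope ereal_scope.

(* The maximum with 0 only serves to give the empty set diameter 0. *)
Definition ediam A : \bar R :=
  maxe 0 (ereal_sup [set (enorm (x - y))%:E | x in A & y in A]).

(* The factor pi / 4 is the area of a disc of diameter 1, so that H^2 is
   normalized to be the area on planes. *)
Definition hausdorff_gauge A : \bar R := (pi / 4%:R)%:E * ediam A ^+ 2.

Definition fine_cover (d : R) A : set ((set 'rV[R]_3)^nat) :=
  [set C | (forall k, ediam (C k) <= d%:E) /\ A `<=` \bigcup_k C k].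

Definition hausdorff_pre (d : R) A : \bar R :=
  ereal_inf [set \sum_(k <oo) hausdorff_gauge (C k) | C in fine_cover d A].

Definition hausdorff2 A : \bar R :=
  ereal_sup [set hausdorff_pre d A | d in [set d : R | (0 < d)%R]].

Lemma ediam_set0 : ediam set0 = 0.
Proof.
rewrite /ediam; suff -> : [set (enorm (x - y))%:E | x in set0 & y in set0] =
  (set0 : set (\bar R)) by rewrite ereal_sup0 maxeNy.
by apply/seteqP; split => // z [x].
Qed.

Lemma ediam_ge0 A : 0 <= ediam A.
Proof. by rewrite /ediam le_max lexx. Qed.

Lemma hausdorff_gauge_ge0 A : 0 <= hausdorff_gauge A.
Proof.
rewrite /hausdorff_gauge mule_ge0 ?expe_ge0 ?ediam_ge0//.
by rewrite lee_fin divr_ge0// pi_ge0.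
Qed.

Lemma hausdorff_gauge0 : hausdorff_gauge set0 = 0.
Proof. by rewrite /hausdorff_gauge ediam_set0 expeS mul0e mule0. Qed.

Lemma hausdorff_pre_ge0 d A : 0 <= hausdorff_pre d A.
Proof.
apply: le_ereal_inf_tmp => _ [C _ <-].
by apply: nneseries_ge0 => n _ _; exact: hausdorff_gauge_ge0.
Qed.

Lemma le_hausdorff_pre d :
  {homo hausdorff_pre d : A B / A `<=` B >-> A <= B}.
Proof.
move=> A B AB; apply: ereal_inf_le_tmp => _ [C [Cd BC] <-].
by exists C => //; split => //; exact: subset_trans AB BC.
Qed.

Lemma hausdorff_pre0 d : (0 < d)%R -> hausdorff_pre d set0 = 0.
Proof.
move=> d0; apply/eqP; rewrite eq_le hausdorff_pre_ge0 andbT.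
apply: ereal_inf_lbound; exists (fun=> set0).
  by split => // k; rewrite ediam_set0 lee_fin ltW.
by rewrite eseries0// => k _ _; exact: hausdorff_gauge0.
Qed.

Lemma hausdorff_pre_sigma_subadditive d : sigma_subadditive (hausdorff_pre d).
Proof.
move=> A; have [[i ioo]|] := pselect (exists i, hausdorff_pre d (A i) = +oo).
  rewrite (eseries_pinfty _ _ ioo) ?leey// => n _.
  by rewrite -ltNye (lt_le_trans _ (hausdorff_pre_ge0 _ _)).
rewrite -forallNE => Aoo.
suff add2e (e : {posnum R}) : hausdorff_pre d (\bigcup_n A n) <=
    \sum_(i <oo) hausdorff_pre d (A i) + e%:num%:E.
  by apply/lee_addgt0Pr => _/posnumP[].
rewrite (le_trans _ (epsilon_trick _ _ _))//; last first.
  by move=> n; exact: hausdorff_pre_ge0.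
pose P n (B : (set 'rV[R]_3)^nat) := fine_cover d (A n) B /\
  \sum_(k <oo) hausdorff_gauge (B k) <=
    hausdorff_pre d (A n) + (e%:num / (2 ^ n.+1)%:R)%:E.
have [G PG] : {G : ((set 'rV[R]_3)^nat)^nat & forall n, P n (G n)}.
  apply: (@choice _ _ P) => n; rewrite /P.
  have en1 : (0 < e%:num / (2 ^ n.+1)%:R)%R by [].
  have fA : hausdorff_pre d (A n) \is a fin_num.
    rewrite ge0_fin_numE ?hausdorff_pre_ge0//.
    by rewrite ltey; apply/eqP; exact: Aoo.
  have [_ [B AB <-] /ltW ?] := lb_ereal_inf_adherent en1 fA.
  by exists B.
have gG0 x : 0 <= (hausdorff_gauge \o uncurry G) x.
  exact: hausdorff_gauge_ge0.
apply: (@le_trans _ _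
    (\esum_(i in setT) (hausdorff_gauge \o uncurry G) i)).
  apply: ereal_inf_lbound => /=.
  have /card_esym/ppcard_eqP[f] := card_nat2.
  exists (uncurry G \o f).
    split => [k|t [i _]] /=.
      by case: (f k) => a b; exact: (PG a).1.1.
    move=> /(PG i).1.2[j _ Gij]; exists (f^-1%FUN (i, j)) => //=.
    by rewrite invK ?inE.
  rewrite -(esum_pred_image (hausdorff_gauge \o uncurry G) _ xpredT)
    ?[fun=> _]set_true//.
  by rewrite image_eq.
rewrite (_ : esum _ _ =
    \sum_(i <oo) \sum_(j <oo) hausdorff_gauge (G i j)); last first.
  pose J : nat -> set (nat * nat) := fun i => [set (i, j) | j in setT].
  rewrite (_ : setT = \bigcup_k J k); last first.
    by rewrite predeqE => -[a b]; split => // _; exists a => //; exists b.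
  rewrite esum_bigcupT /=; last 2 first.
    - apply/trivIsetP => i j _ _ ij.
      rewrite predeqE => -[n m] /=; split => //= -[] [_] _ [<-{n} _].
      by move=> [m' _] [] /esym/eqP; rewrite (negbTE ij).
    - by move=> /= [n m]; exact: hausdorff_gauge_ge0.
  rewrite -(image_id [set: nat]) -fun_true esum_pred_image//; last first.
    by move=> n _; apply: esum_ge0 => x _; exact: gG0.
  apply: eq_eseriesr => /= j _.
  rewrite -(esum_pred_image (hausdorff_gauge \o uncurry G) (pair j) predT)//=;
    last 2 first.
    - by move=> n _; exact: hausdorff_gauge_ge0.
    - by move=> ? ? _ _; exact: (@can_inj _ _ _ snd).
  by congr esum; rewrite predeqE => -[a b]; split; move=> [i _ <-]; exists i.
apply: lee_nneseries => [n _ _|n _]; last exact: (PG n).2.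
by apply: nneseries_ge0 => m _ _; exact: hausdorff_gauge_ge0.
Qed.

Lemma hausdorff2_set0 : hausdorff2 set0 = 0.
Proof.
rewrite /hausdorff2 (_ : image _ _ = [set 0]) ?ereal_sup1//.
apply/seteqP; split => [_ [d /= d0 <-]|_ ->]; first exact: hausdorff_pre0.
by exists 1%R => /=; [exact: ltr01|rewrite hausdorff_pre0].
Qed.

Lemma hausdorff2_ge0 A : 0 <= hausdorff2 A.
Proof.
apply: (le_trans (hausdorff_pre_ge0 1 A)).
by apply: ereal_sup_ubound; exists 1%R => //=; exact: ltr01.
Qed.

Lemma le_hausdorff2 : {homo hausdorff2 : A B / A `<=` B >-> A <= B}.
Proof.
move=> A B AB; apply: ge_ereal_sup => _ [d d0 <-].
apply: (le_trans (le_hausdorff_pre d AB)).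
by apply: ereal_sup_ubound; exists d.
Qed.

Lemma hausdorff2_sigma_subadditive : sigma_subadditive hausdorff2.
Proof.
move=> A; apply: ge_ereal_sup => _ [d d0 <-].
apply: (le_trans (hausdorff_pre_sigma_subadditive d A)).
apply: lee_nneseries => [n _ _|n _]; first exact: hausdorff_pre_ge0.
by apply: ereal_sup_ubound; exists d.
Qed.

HB.instance Definition _ := isOuterMeasure.Build R 'rV[R]_3 hausdorff2
  hausdorff2_set0 hausdorff2_ge0 le_hausdorff2 hausdorff2_sigma_subadditive.

Definition hausdorff2_outer : {outer_measure set 'rV[R]_3 -> \bar R} :=
  hausdorff2.

Definition H2 : {measure set (caratheodory_type hausdorff2_outer) -> \bar R} :=
  hausdorff2_outer.

End hausdorff.

Section menger.
Context {R : realType}.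
Implicit Types x y z : 'rV[R]_3.

Definition coplanar x0 x1 x2 x3 : Prop :=
  exists2 P : {vspace 'rV[R]_3}, \dim P = 2%N &
    [/\ x1 - x0 \in P, x2 - x0 \in P & x3 - x0 \in P].

Definition tetra_volume x0 x1 x2 x3 : R :=
  `|\det (\matrix_(i < 3) tnth [tuple x1 - x0; x2 - x0; x3 - x0] i)| / 6%:R.

(* Half the area of the parallelogram spanned by y - x and z - x, computed from
   its Gram determinant. *)
Definition triangle_area x y z : R :=
  let u := y - x in let v := z - x in
  Num.sqrt (dotp u u * dotp v v - dotp u v ^+ 2) / 2%:R.

Definition tetra_area x0 x1 x2 x3 : R :=
  triangle_area x1 x2 x3 + triangle_area x0 x2 x3 +
  triangle_area x0 x1 x3 + triangle_area x0 x1 x2.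

Definition tetra_diam x0 x1 x2 x3 : R :=
  let s := [:: x0; x1; x2; x3] in
  \big[Num.max/0]_(x <- s) \big[Num.max/0]_(y <- s) enorm (x - y).

Definition menger_curvature x0 x1 x2 x3 : R :=
  if `[< coplanar x0 x1 x2 x3 >] then 0
  else tetra_volume x0 x1 x2 x3 /
    (tetra_area x0 x1 x2 x3 * tetra_diam x0 x1 x2 x3 ^+ 2).

Definition integral_menger (p : R) (S : set 'rV[R]_3) : \bar R :=
  (\int[H2]_(x3 in S) \int[H2]_(x2 in S) \int[H2]_(x1 in S) \int[H2]_(x0 in S)
    (menger_curvature x0 x1 x2 x3 `^ p)%:E)%E.

End menger.

(* Main.v *)
Require Import Defs.
From HB Require Import structures.
From mathcomp Require Import all_boot all_order all_algebra.
From mathcomp Require Import all_classical all_reals all_analysis.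
From mathcomp Require Import ring lra.
Import Order.TTheory GRing.Theory Num.Theory.
Import numFieldNormedType.Exports.
Local Open Scope classical_set_scope.
Local Open Scope ring_scope.

Set Implicit Arguments.
Unset Strict Implicit.
Unset Printing Implicit Defensive.

(** Throughout, [S] is the boundary of a bounded domain [U]. The central notion is
    two-sided flatness at a point [x] and a scale [r] ([flat_two_sided]): the part
    of [S] in the ball of radius [r] lies in a slab of thickness [r / 10], and the
    two caps of the ball outside of the slab lie on different sides of [S].

    If this holds, every segment orthogonal to the slab crosses [S], so that [S]
    projects onto a disc of radius comparable to [r] ([big_projection]). Two facts
    follow: [S] has area at least a multiple of [r ^ 2] in the ball, and it
    contains two points which together with [x] span a plane in a quantitative way.

    The energy then controls the flatness at the scale [2 * r]
    ([flat_of_energy]). Take [x], two such points, and a fourth point of [S] at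
    relative height [b] over their plane. All tetrahedra with vertices in balls of
    radius about [b * r] around these four points have curvature at least of order
    [b / r], and by the area bound they carry the energy
    [(b / r) ^ p * (b * r) ^ 8] up to a factor. Hence
    [b ^ (p + 8) <= C * E * r ^ (p - 8)], which is small for [p > 8] and [r] at
    most a small multiple of [E ^ (- 1 / (p - 8))].

    So as long as [r] stays below this radius, two-sided flatness passes from the
    scale [r] to [2 * r] ([flat_two_sided_double]). The induction starts at a
    scale that depends on [S]: there the local Lipschitz graphs give big
    projections with a constant that depends on the graphs, [flat_of_energy]
    turns them into flatness, and the two sides of the graph lie on different
    sides of [S] ([two_sided_height_function]), for otherwise the connectedness
    of [S] would make the closure of [U] open ([boundary_not_interior_closure]).
    Compactness makes this starting scale uniform, and from there one doubles up
    to the radius that depends on [p] and [E] alone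
    ([all_scales_flat_two_sided]).

    Below this radius the normals of the slabs at consecutive dyadic scales form
    angles of order [r ^ ((p - 8) / (p + 16))], because [S] spans every plane that
    it is close to ([normals_close]). They converge geometrically to the normal of
    a tangent plane ([tangent_normal]), and comparing the slabs of two points at
    the scale of their distance gives the Hoelder estimate
    ([tangent_normals_close]).

    On the measure-theoretic side, only lower bounds occur: the projection
    estimate bounds the Hausdorff measure from below by the Lebesgue measure of
    squares, and nested integrals are bounded from below on products of closed
    sets, which are measurable by the Caratheodory criterion. *)

(** * Vectors, cross products and angles in Euclidean space *)


Section vector_algebra.
Context {R : realType}.
Implicit Types (u v w x y z n m e : 'rV[R]_3) (a b c t : R).

Lemma sum3E (F : 'I_3 -> R) : \sum_i F i = F 0 + F 1 + F 2%:R.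
Proof.
rewrite !big_ord_recl big_ord0 addr0 addrA.
by congr (_ + _ + _);
  congr (F _); apply: val_inj.
Qed.

Lemma dotpE u v : dotp u v =
  u 0 0 * v 0 0 + u 0 1 * v 0 1 + u 0 2%:R * v 0 2%:R.
Proof. by rewrite /dotp sum3E. Qed.

Lemma row3P u v : u 0 0 = v 0 0 -> u 0 1 = v 0 1 -> u 0 2%:R = v 0 2%:R -> u = v.
Proof.
move=> h0 h1 h2; apply/rowP => -[[|[|[|//]]] i3].
- by rewrite (_ : Ordinal i3 = 0) //; apply: val_inj.
- by rewrite (_ : Ordinal i3 = 1) //; apply: val_inj.
- by rewrite (_ : Ordinal i3 = 2%:R) //; apply: val_inj.
Qed.

Definition cross u v : 'rV[R]_3 :=
  \row_j (u 0 (j + 1) * v 0 (j + 2%:R) - u 0 (j + 2%:R) * v 0 (j + 1)).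

Lemma cross0E u v : cross u v 0 0 = u 0 1 * v 0 2%:R - u 0 2%:R * v 0 1.
Proof. by rewrite mxE !add0r. Qed.

Lemma cross1E u v : cross u v 0 1 = u 0 2%:R * v 0 0 - u 0 0 * v 0 2%:R.
Proof.
by rewrite mxE; congr (u _ _ * v _ _ - u _ _ * v _ _); apply: val_inj.
Qed.

Lemma cross2E u v : cross u v 0 2%:R = u 0 0 * v 0 1 - u 0 1 * v 0 0.
Proof.
by rewrite mxE; congr (u _ _ * v _ _ - u _ _ * v _ _); apply: val_inj.
Qed.

Lemma add3E u v i : (u + v) 0 i = u 0 i + v 0 i. Proof. by rewrite mxE. Qed.
Lemma opp3E u i : (- u) 0 i = - u 0 i. Proof. by rewrite mxE. Qed.
Lemma scale3E a u i : (a *: u) 0 i = a * u 0 i. Proof. by rewrite mxE. Qed.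
Lemma zero3E i : (0 : 'rV[R]_3) 0 i = 0. Proof. by rewrite mxE. Qed.

Definition coordE :=
  (dotpE, cross0E, cross1E, cross2E, add3E, opp3E, scale3E, zero3E).

Lemma dotpC u v : dotp u v = dotp v u.
Proof. by rewrite !coordE; ring. Qed.
Lemma dotpDl u v w : dotp (u + v) w = dotp u w + dotp v w.
Proof. by rewrite !coordE; ring. Qed.
Lemma dotpDr u v w : dotp w (u + v) = dotp w u + dotp w v.
Proof. by rewrite !coordE; ring. Qed.
Lemma dotpNl u w : dotp (- u) w = - dotp u w.
Proof. by rewrite !coordE; ring. Qed.
Lemma dotpNr u w : dotp w (- u) = - dotp w u.
Proof. by rewrite !coordE; ring. Qed.
Lemma dotpBl u v w : dotp (u - v) w = dotp u w - dotp v w.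
Proof. by rewrite dotpDl dotpNl. Qed.
Lemma dotpBr u v w : dotp w (u - v) = dotp w u - dotp w v.
Proof. by rewrite dotpDr dotpNr. Qed.
Lemma dotpZl a u w : dotp (a *: u) w = a * dotp u w.
Proof. by rewrite !coordE; ring. Qed.
Lemma dotpZr a u w : dotp w (a *: u) = a * dotp w u.
Proof. by rewrite !coordE; ring. Qed.
Lemma dotp0l u : dotp 0 u = 0.
Proof. by rewrite !coordE; ring. Qed.
Definition dotp_lin := (dotpDl, dotpDr, dotpNl, dotpNr, dotpZl, dotpZr).

Lemma dotp_ge0 u : 0 <= dotp u u.
Proof. by rewrite /dotp sumr_ge0 // => i _; rewrite -expr2 sqr_ge0. Qed.

Lemma dotp_eq0 u : dotp u u = 0 -> u = 0.
Proof.
move=> /eqP; rewrite /dotp psumr_eq0 => [/allP u0|i _]; last first.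
  by rewrite -expr2 sqr_ge0.
apply/rowP => i; have := u0 i; rewrite mem_index_enum => /(_ isT) /=.
by rewrite mulf_eq0 orbb mxE => /eqP.
Qed.

Lemma enorm_ge0 u : 0 <= enorm u.
Proof. exact: sqrtr_ge0. Qed.

Lemma sqr_enorm u : enorm u ^+ 2 = dotp u u.
Proof. by rewrite /enorm sqr_sqrtr ?dotp_ge0. Qed.

Lemma enorm0 : enorm (0 : 'rV[R]_3) = 0.
Proof. by rewrite /enorm dotp0l sqrtr0. Qed.

Lemma enorm_eq0 u : enorm u = 0 -> u = 0.
Proof. by move=> u0; apply: dotp_eq0; rewrite -sqr_enorm u0 expr0n. Qed.

Lemma enorm_gt0 u : u != 0 -> 0 < enorm u.
Proof.
move=> u0; rewrite lt_def enorm_ge0 andbT; apply: contra u0 => /eqP.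
by move=> /enorm_eq0 ->.
Qed.

Lemma enormN u : enorm (- u) = enorm u.
Proof. by rewrite /enorm dotpNl dotpNr opprK. Qed.

Lemma enormZ a u : enorm (a *: u) = `|a| * enorm u.
Proof.
by rewrite /enorm dotpZl dotpZr mulrA -expr2 sqrtrM ?sqr_ge0 // sqrtr_sqr.
Qed.

Lemma enormB u v : enorm (u - v) = enorm (v - u).
Proof. by rewrite -enormN opprB. Qed.

Lemma enorm_le a u : 0 <= a -> dotp u u <= a ^+ 2 -> enorm u <= a.
Proof.
move=> a0 h; rewrite -(ler_pXn2r (n := 2)) ?nnegrE ?enorm_ge0 //.
by rewrite sqr_enorm.
Qed.

Lemma sqr_cross u v :
  enorm (cross u v) ^+ 2 = (enorm u * enorm v) ^+ 2 - dotp u v ^+ 2.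
Proof. by rewrite exprMn !sqr_enorm !coordE; ring. Qed.

Lemma cauchy_schwarz u v : `|dotp u v| <= enorm u * enorm v.
Proof.
rewrite -(ler_pXn2r (n := 2)) ?nnegrE ?mulr_ge0 ?enorm_ge0 //.
by rewrite real_normK ?num_real // -subr_ge0 -sqr_cross sqr_ge0.
Qed.

Lemma enorm_cross_le u v : enorm (cross u v) <= enorm u * enorm v.
Proof.
rewrite -(ler_pXn2r (n := 2)) ?nnegrE ?mulr_ge0 ?enorm_ge0 //.
by rewrite sqr_cross gerBl sqr_ge0.
Qed.

Lemma enormD u v : enorm (u + v) <= enorm u + enorm v.
Proof.
apply: enorm_le; first by rewrite addr_ge0 ?enorm_ge0.
have := ler_norm (dotp u v); have := cauchy_schwarz u v.
rewrite sqrrD !sqr_enorm !(dotpDl, dotpDr) (dotpC v u); lra.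
Qed.

Lemma enormBD u v : enorm (u - v) <= enorm u + enorm v.
Proof. by rewrite -(enormN v) enormD. Qed.

Lemma enorm_tri y x z : enorm (x - z) <= enorm (x - y) + enorm (y - z).
Proof. by rewrite -[x - z](subrKA y) enormD. Qed.

Lemma enorm_coord u i : `|u 0 i| <= enorm u.
Proof.
rewrite -(ler_pXn2r (n := 2)) ?nnegrE ?enorm_ge0 //.
rewrite real_normK ?num_real // sqr_enorm /dotp (bigD1 i) //= -expr2.
by rewrite lerDl sumr_ge0 // => j _; rewrite -expr2 sqr_ge0.
Qed.

Lemma enorm_le_coord u : enorm u <= `|u 0 0| + `|u 0 1| + `|u 0 2%:R|.
Proof.
apply: enorm_le; first by rewrite !addr_ge0.
have s i : u 0 i * u 0 i = `|u 0 i| ^+ 2.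
  by rewrite real_normK ?num_real // expr2.
rewrite dotpE !s; move: (normr_ge0 (u 0 0)) (normr_ge0 (u 0 1)).
move: (normr_ge0 (u 0 2%:R)) => h0 h1 h2.
have := mulr_ge0 h0 h1; have := mulr_ge0 h0 h2; have := mulr_ge0 h1 h2; lra.
Qed.

Lemma pythagoras n w a : enorm n = 1 -> dotp w n = 0 ->
  enorm (w + a *: n) ^+ 2 = enorm w ^+ 2 + a ^+ 2.
Proof.
move=> n1 wn; rewrite !sqr_enorm !dotp_lin (dotpC n w) wn -(sqr_enorm n) n1; ring.
Qed.

Definition tdet u v w := dotp (cross u v) w.

Lemma tdet_le u v w : `|tdet u v w| <= enorm u * enorm v * enorm w.
Proof.
apply: le_trans (cauchy_schwarz _ _) _.
by rewrite ler_wpM2r ?enorm_ge0 // enorm_cross_le.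
Qed.

Lemma tdetB u v w u' v' w' : tdet u' v' w' - tdet u v w =
  tdet (u' - u) v' w' + tdet u (v' - v) w' + tdet u v (w' - w).
Proof. by rewrite /tdet !coordE; ring. Qed.

Lemma det2E (A : 'M[R]_2) : \det A = A 0 0 * A 1 1 - A 0 1 * A 1 0.
Proof.
rewrite (expand_det_row _ 0) !big_ord_recl big_ord0 /cofactor !det_mx11 !mxE /=.
have l0 : lift (0 : 'I_2) (0 : 'I_1) = 1 by apply: val_inj.
have l1 : lift (1 : 'I_2) (0 : 'I_1) = 0 by apply: val_inj.
by rewrite !l0 l1 /= expr0 expr1; ring.
Qed.

Lemma det_tdet u v w :
  \det (\matrix_(i < 3) tnth [tuple u; v; w] i) = tdet u v w.
Proof.
rewrite (expand_det_row _ 0) sum3E /cofactor !det2E !mxE /=.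
have l00 : lift (0 : 'I_3) (0 : 'I_2) = 1 by apply: val_inj.
have l01 : lift (0 : 'I_3) (1 : 'I_2) = 2%:R by apply: val_inj.
have l10 : lift (1 : 'I_3) (0 : 'I_2) = 0 by apply: val_inj.
have l11 : lift (1 : 'I_3) (1 : 'I_2) = 2%:R by apply: val_inj.
have l20 : lift (2%:R : 'I_3) (0 : 'I_2) = 0 by apply: val_inj.
have l21 : lift (2%:R : 'I_3) (1 : 'I_2) = 1 by apply: val_inj.
rewrite !(l00, l01, l10, l11, l20, l21) /tdet !coordE.
have t0 : tnth [tuple u; v; w] 0 = u by [].
have t1 : tnth [tuple u; v; w] 1 = v by [].
have t2 : tnth [tuple u; v; w] 2%:R = w by [].
rewrite !(t0, t1, t2) /= !(expr0, expr1).
by rewrite (_ : (-1) ^+ (0 + _) = 1 :> R) ?(expr2,mulN1r,opprK) //; ring.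
Qed.

Lemma cross_dotl u v : dotp u (cross u v) = 0.
Proof. by rewrite !coordE; ring. Qed.
Lemma cross_dotr u v : dotp v (cross u v) = 0.
Proof. by rewrite !coordE; ring. Qed.

Lemma crossC u v : cross u v = - cross v u.
Proof. by apply: row3P; rewrite !coordE; ring. Qed.

Lemma cross_cross n u v :
  cross n (cross u v) = dotp n v *: u - dotp n u *: v.
Proof. by apply: row3P; rewrite !coordE; ring. Qed.

Lemma orthonormal_complement e : enorm e = 1 -> exists f g,
  [/\ enorm f = 1, enorm g = 1, dotp f e = 0, dotp g e = 0 &
      dotp f g = 0 /\ cross f g = e].
Proof.
move=> e1.
have [f f1 fe] : exists2 f, enorm f = 1 & dotp f e = 0.
  have mk h : h != 0 -> dotp h e = 0 ->
      exists2 f, enorm f = 1 & dotp f e = 0.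
    move=> /enorm_gt0 h0 he; exists ((enorm h)^-1 *: h).
      by rewrite enormZ gtr0_norm ?invr_gt0 // mulVf ?gt_eqF.
    by rewrite dotpZl he mulr0.
  have [/eqP h0|h0] := boolP (cross e (delta_mx 0 0) == 0); last first.
    by apply: (mk _ h0); rewrite dotpC cross_dotl.
  have [/eqP h1|h1] := boolP (cross e (delta_mx 0 1) == 0); last first.
    by apply: (mk _ h1); rewrite dotpC cross_dotl.
  exfalso; suff e0 : e = 0 by move: e1; rewrite e0 enorm0 => /eqP; rewrite eq_sym oner_eq0.
  have a1 := cross1E e (delta_mx 0 0); have a2 := cross2E e (delta_mx 0 0).
  have b2 := cross2E e (delta_mx 0 1).
  move: a1 a2 b2; rewrite h0 h1 !mxE /= !mulr1 !mulr0 => a1 a2 b2.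
  by apply: row3P; rewrite !coordE; lra.
exists f, (cross e f).
have fg : dotp f (cross e f) = 0 by rewrite cross_dotr.
have ge : dotp (cross e f) e = 0 by rewrite dotpC cross_dotl.
split => //.
  apply/eqP; rewrite -(eqrXn2 (n := 2)) ?enorm_ge0 // sqr_cross e1 f1.
  by rewrite dotpC fe; apply/eqP; ring.
split => //; rewrite cross_cross fe scale0r subr0.
by rewrite -sqr_enorm f1 expr1n scale1r.
Qed.

(** The norm of the cross product of two unit vectors is the sine of the angle
    between the lines they span; it is a pseudometric that ignores the
    orientation of the vectors. *)
Definition sine n m := enorm (cross n m).

Lemma sine_ge0 n m : 0 <= sine n m. Proof. exact: enorm_ge0. Qed.

Lemma sineC n m : sine n m = sine m n.
Proof. by rewrite /sine crossC enormN. Qed.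

Lemma sinenn n : sine n n = 0.
Proof.
by rewrite /sine (_ : cross n n = 0) ?enorm0 //; apply: row3P; rewrite !coordE; ring.
Qed.

Lemma sqr_sine n m : enorm n = 1 -> enorm m = 1 ->
  sine n m ^+ 2 = 1 - dotp n m ^+ 2.
Proof. by move=> n1 m1; rewrite /sine sqr_cross n1 m1 mulr1 expr1n. Qed.

Lemma dotp_unit_le n m : enorm n = 1 -> enorm m = 1 -> `|dotp n m| <= 1.
Proof. by move=> n1 m1; have := cauchy_schwarz n m; rewrite n1 m1 mulr1. Qed.

Lemma unit_decomposition n m : enorm n = 1 -> enorm m = 1 ->
  exists2 w, n = dotp n m *: m + w & enorm w = sine n m /\ dotp w m = 0.
Proof.
move=> n1 m1; exists (n - dotp n m *: m); first by rewrite addrC subrK.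
have wm : dotp (n - dotp n m *: m) m = 0.
  by rewrite dotpBl dotpZl -sqr_enorm m1; ring.
split => //; apply/eqP.
rewrite -(eqrXn2 (n := 2)) ?enorm_ge0 // ?sine_ge0 // sqr_sine //.
have := pythagoras (dotp n m) m1 wm.
by rewrite subrK n1 => h; apply/eqP; lra.
Qed.

Lemma dotp_sine n m w : enorm n = 1 -> enorm m = 1 ->
  `|dotp w n| <= `|dotp w m| + sine n m * enorm w.
Proof.
move=> n1 m1; have [v nv [vs _]] := unit_decomposition n1 m1.
rewrite {1}nv dotpDr dotpZr; apply: le_trans (ler_normD _ _) _.
rewrite lerD //; last by rewrite mulrC -vs cauchy_schwarz.
by rewrite normrM ler_piMl // dotp_unit_le.
Qed.

Lemma sine_tri m n k : enorm n = 1 -> enorm m = 1 -> enorm k = 1 ->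
  sine n k <= sine n m + sine m k.
Proof.
move=> n1 m1 k1; have [v nv [vs _]] := unit_decomposition n1 m1.
have -> : sine n k = enorm (dotp n m *: cross m k + cross v k).
  rewrite /sine {1}nv; congr enorm; apply: row3P; rewrite !coordE; ring.
apply: le_trans (enormD _ _) _; rewrite addrC lerD //.
  by rewrite -vs; have := enorm_cross_le v k; rewrite k1 mulr1.
by rewrite enormZ ler_piMl ?enorm_ge0 // dotp_unit_le.
Qed.

Lemma sine_eq0_dotp n m w : enorm n = 1 -> enorm m = 1 -> sine n m = 0 ->
  dotp w m = 0 -> dotp w n = 0.
Proof.
move=> n1 m1 s0 wm; have := dotp_sine w n1 m1.
by rewrite s0 wm normr0 mul0r addr0 normr_le0 => /eqP.
Qed.

(** Two vectors of a plane that are quantitatively independent determine its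
    normal: a unit vector almost orthogonal to both is almost parallel to their
    cross product. *)
Lemma sine_cross_le n u v (r c h : R) : enorm n = 1 -> 0 < r -> 0 < c ->
  enorm u <= r -> enorm v <= r -> c * r ^+ 2 <= enorm (cross u v) ->
  `|dotp u n| <= h -> `|dotp v n| <= h ->
  sine n ((enorm (cross u v))^-1 *: cross u v) <= 2%:R * h / (c * r).
Proof.
move=> n1 r0 c0 ur vr cr uh vh.
set N := enorm (cross u v) in cr *.
have cr0 : 0 < c * r ^+ 2 by rewrite mulr_gt0 ?exprn_gt0.
have N0 : 0 < N by apply: lt_le_trans cr.
have -> : sine n (N^-1 *: cross u v) = N^-1 * enorm (cross n (cross u v)).
  rewrite /sine -[N^-1]gtr0_norm ?invr_gt0 // -enormZ gtr0_norm ?invr_gt0 //.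
  by congr enorm; apply: row3P; rewrite !coordE; ring.
have h0 : 0 <= h by apply: le_trans uh.
have : enorm (cross n (cross u v)) <= 2%:R * h * r.
  rewrite cross_cross; apply: le_trans (enormBD _ _) _; rewrite !enormZ.
  rewrite (dotpC n u) (dotpC n v).
  have := ler_pM (normr_ge0 _) (enorm_ge0 _) uh vr.
  have := ler_pM (normr_ge0 _) (enorm_ge0 _) vh ur; lra.
move=> hr; apply: (@le_trans _ _ (N^-1 * (2%:R * h * r))).
  by rewrite ler_wpM2l // invr_ge0 ltW.
rewrite ler_pdivlMr ?mulr_gt0 // -[X in X <= _]mulrA ler_pdivrMl //.
have := ler_wpM2l (mulr_ge0 (ler0n R 2) h0) cr; lra.
Qed.

Lemma enorm_cross_gt0_unit u v : 0 < enorm (cross u v) ->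
  enorm ((enorm (cross u v))^-1 *: cross u v) = 1.
Proof.
by move=> N0; rewrite enormZ gtr0_norm ?invr_gt0 // mulVf // gt_eqF.
Qed.

End vector_algebra.

(** * Euclidean balls and segments across the boundary of an open set *)

Section euclidean_topology.
Context {R : realType}.
Implicit Types (u v w x y z n m e : 'rV[R]_3) (a b c t : R) (S U : set 'rV[R]_3).

Lemma ball_normrV x r y : ball x r y <-> `|x - y| < r.
Proof. by rewrite -ball_normE. Qed.

Lemma normrV_le_enorm u : `|u| <= enorm u.
Proof.
rewrite [`|u|]/Num.norm /= mx_normrE; apply/bigmax_leP; split => [|[i j] _].
  exact: enorm_ge0.
by rewrite (ord1 i) enorm_coord.
Qed.

Lemma enorm_le_normrV u : enorm u <= 3%:R * `|u|.
Proof.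
have h j : `|u 0 j| <= `|u|.
  by rewrite [leRHS]/Num.norm /= mx_normrE; apply/bigmax_geP; right => /=; exists (0, j).
by have := enorm_le_coord u; have := h 0; have := h 1; have := h 2%:R; lra.
Qed.

Lemma nbhs_enormP x (A : set 'rV[R]_3) :
  nbhs x A <-> exists2 d : R, 0 < d & forall y, enorm (y - x) < d -> A y.
Proof.
split=> [/nbhs_ballP[d /= d0 dA]|[d d0 dA]].
  exists d => // y yx; apply: dA; apply/ball_normrV; rewrite distrC.
  exact: le_lt_trans (normrV_le_enorm _) yx.
apply/nbhs_ballP; exists (d / 3%:R) => /=; first by rewrite divr_gt0.
move=> y /ball_normrV; rewrite distrC => yx; apply: dA.
by apply: le_lt_trans (enorm_le_normrV _) _; move: yx; rewrite ltr_pdivlMr // mulrC.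
Qed.

Lemma openP_enorm U : open U <-> forall x, U x ->
  exists2 d : R, 0 < d & forall y, enorm (y - x) < d -> U y.
Proof.
rewrite openE; split=> h x Ux; first exact/nbhs_enormP/h.
by apply/nbhs_enormP/h.
Qed.

Lemma closureP_enorm U x : closure U x <-> forall d : R, 0 < d ->
  exists2 y, U y & enorm (y - x) < d.
Proof.
split=> [cx d d0|h B /nbhs_enormP[d d0 dB]]; last first.
  by have [y Uy yx] := h d d0; exists y; split => //; exact: dB.
have [|y [Uy /= yd]] := cx [set y | enorm (y - x) < d].
  by apply/nbhs_enormP; exists d.
by exists y.
Qed.

Lemma lipschitz_enorm_continuous (K : R) (f : 'rV[R]_3 -> R) :
  (forall x y, `|f x - f y| <= K * enorm (x - y)) -> continuous f.
Proof.
move=> fK x; apply/(@cvgrPdist_lt R R _ (nbhs x) _ f) => eps eps0.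
apply/nbhs_enormP; exists (eps / (`|K| + 1)).
  by rewrite divr_gt0 // ltr_wpDl.
move=> y; rewrite ltr_pdivlMr ?ltr_wpDl // => h.
apply: le_lt_trans (fK _ _) _; rewrite enormB; apply: le_lt_trans h.
rewrite mulrC; apply: ler_wpM2l; first exact: enorm_ge0.
by have := ler_norm K; lra.
Qed.

Lemma closed_lipschitz_le (K : R) (f : 'rV[R]_3 -> R) r :
  (forall x y, `|f x - f y| <= K * enorm (x - y)) -> closed [set x | f x <= r].
Proof.
move=> /lipschitz_enorm_continuous fc.
apply: (@preimage_closed _ _ f [set x | x <= r]) => [x _|]; first exact: fc.
exact: closed_le.
Qed.

Lemma enorm_dist_le x y : `|enorm x - enorm y| <= enorm (x - y).
Proof.
have := enormD (x - y) y; have := enormD (y - x) x.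
by rewrite !subrK (enormB y x) ler_norml; lra.
Qed.

Lemma closed_eball x r : closed [set y | enorm (y - x) <= r].
Proof.
apply: (@closed_lipschitz_le 1) => y z; rewrite mul1r.
by apply: le_trans (enorm_dist_le _ _) _; rewrite opprB addrA subrK.
Qed.

Definition ray (a b : 'rV[R]_3) (t : R) : 'rV[R]_3 := a + t *: (b - a).

Lemma ray0 x y : ray x y 0 = x. Proof. by rewrite /ray scale0r addr0. Qed.
Lemma ray1 x y : ray x y 1 = y. Proof. by rewrite /ray scale1r addrC subrK. Qed.

Lemma rayC x y t : ray x y t = ray y x (1 - t).
Proof. by apply: row3P; rewrite /ray !coordE; ring. Qed.

Lemma continuous_ray x y : continuous (ray x y).
Proof.
move=> t; apply: cvgD; first exact: cvg_cst.
by apply: cvgZr_tmp; exact: cvg_id.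
Qed.

Lemma dotp_ray x y t n : dotp (ray x y t) n = (1 - t) * dotp x n + t * dotp y n.
Proof. by rewrite /ray !coordE; ring. Qed.

Lemma ray_ball_le z x y t r : 0 <= t <= 1 -> enorm (x - z) <= r ->
  enorm (y - z) <= r -> enorm (ray x y t - z) <= r.
Proof.
move=> /andP[t0 t1] xr yr.
have -> : ray x y t - z = (1 - t) *: (x - z) + t *: (y - z).
  by apply: row3P; rewrite /ray !coordE; ring.
apply: le_trans (enormD _ _) _; rewrite !enormZ !ger0_norm ?subr_ge0 //.
have := ler_wpM2l t0 yr; have t2 : 0 <= 1 - t by lra.
by have := ler_wpM2l t2 xr; lra.
Qed.

Lemma ray_halfspace_gt n x y t (h : R) : 0 <= t <= 1 -> h < dotp x n ->
  h < dotp y n -> h < dotp (ray x y t) n.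
Proof.
move=> /andP[t0 t1] hx hy; rewrite dotp_ray.
have [->|t0'] := eqVneq t 0; first lra.
have {t0'}t0 : 0 < t by rewrite lt_def t0' t0.
have := mulr_gt0 t0 (_ : 0 < dotp y n - h); rewrite subr_gt0 => /(_ hy).
have := @mulr_ge0 R (1 - t) (dotp x n - h); rewrite !subr_ge0 => /(_ t1 (ltW hx)).
lra.
Qed.

Definition avoids S x y := forall t, 0 <= t <= 1 -> ~ S (ray x y t).

Lemma avoidsC S x y : avoids S x y -> avoids S y x.
Proof. by move=> h t t01; rewrite rayC; apply: h; lra. Qed.

(** A segment that avoids the boundary of an open set cannot leave it: the
    parameters for which the segment is in the set form a clopen subset of
    the unit interval. *)
Lemma avoids_boundary_in U x y : open U -> avoids (boundary U) x y -> U x -> U y.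
Proof.
move=> oU av Ux.
have cU t : 0 <= t <= 1 -> closure U (ray x y t) -> U (ray x y t).
  move=> t01 ct; have := av t t01; rewrite /boundary (interior_id U).1 //.
  by move=> nb; apply: contrapT => nU; apply: nb.
have cont : continuous (ray x y) by exact: continuous_ray.
have B0 : (`[0, 1]%classic `&` (ray x y @^-1` U)) !=set0.
  by exists 0; split => /=; rewrite ?in_itv /= ?lexx ?ler01 // ray0.
suff E : `[0, 1]%classic `&` (ray x y @^-1` U) = `[0, 1]%classic.
  have : (`[0, 1]%classic : set R) 1 by rewrite /= in_itv /= ler01 lexx.
  by rewrite -E => -[_ /=]; rewrite ray1.
apply: (@segment_connected R 0 1 _ B0).
- exists (ray x y @^-1` U) => //.
  by apply: open_comp => // t _; exact: cont.
- exists (ray x y @^-1` closure U).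
    by apply: preimage_closed => [t _|]; [exact: cont|exact: closed_closure].
  apply/seteqP; split => t [t01 /= Ut]; split => //; first exact: subset_closure.
  by apply: cU => //; move: t01; rewrite /= in_itv.
Qed.

Lemma avoids_boundary_out U x y : open U -> avoids (boundary U) x y ->
  ~ closure U x -> ~ closure U y.
Proof.
move=> oU av nx cy; apply: nx; apply: subset_closure.
apply: avoids_boundary_in (avoidsC av) _ => //.
have := av 1; rewrite ler01 lexx ray1 => /(_ isT).
rewrite /boundary (interior_id U).1 // => nb.
by apply: contrapT => nU; apply: nb.
Qed.

Lemma boundary_crossing U x y : open U -> U x -> ~ closure U y ->
  exists2 t, 0 <= t <= 1 & boundary U (ray x y t).
Proof.
move=> oU Ux Uy; apply: contrapT => h; apply: Uy.
apply: subset_closure; apply: avoids_boundary_in Ux => // t t01 bt.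
by apply: h; exists t.
Qed.


End euclidean_topology.

(** * Lower bounds for integrals *)

Section lower_integral.
Import HBNNSimple.
Context {R : realType}.

(** The integral is the supremum over the measurable simple functions below [f], of
    which [c] times the indicator of [A] is one; this serves for iterated
    integrals, whose inner integrals are not known to be measurable. *)
Lemma integral_ge_cst d (T : measurableType d) (mu : {measure set T -> \bar R})
    (D A : set T) (f : T -> \bar R) (c m : R) :
  measurable A -> A `<=` D -> 0 <= c -> (m%:E <= mu A)%E ->
  (forall x, D x -> (0 <= f x)%E) -> (forall x, A x -> (c%:E <= f x)%E) ->
  ((c * m)%:E <= \int[mu]_(x in D) f x)%E.
Proof.
move=> mA AD c0 mle f0 fc; rewrite ge0_integralE //.
apply: (@le_trans _ _ (c%:E * mu A)%E); first by rewrite EFinM lee_wpmul2l.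
apply: le_ereal_sup_tmp.
exists (sintegral mu (scale_nnsfun (indic_nnsfun R mA) c0)); last first.
  by rewrite -(sintegral_indic mu A) -(sintegralrM _ _ (indic_nnsfun R mA)).
exists (scale_nnsfun (indic_nnsfun R mA) c0) => // x /=.
rewrite -[measurable_realfun.mindic R mA x]/(\1_A x).
rewrite patchE; case: ifPn => [xD|/negP xD]; last first.
  have -> : \1_A x = 0 :> R; last by rewrite mulr0.
  by rewrite indicE memNset // => /AD /mem_set.
have [xA|xA] := boolP (x \in A); rewrite indicE ?xA ?(negbTE xA).
  by rewrite mulr1 fc //; exact/set_mem.
by rewrite mulr0 f0 //; exact/set_mem.
Qed.

End lower_integral.

(** * The Hausdorff measure is a metric outer measure *)

Section hausdorff_separated.
Context {R : realType}.
Implicit Types (A B X F : set 'rV[R]_3).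
Local Open Scope ereal_scope.

Lemma ereal_sup_fun_ge (T : Type) (D : set T) (f : T -> \bar R) t : D t ->
  f t <= ereal_sup [set f s | s in D].
Proof. by move=> Dt; apply: ereal_sup_ubound; exists t. Qed.

Lemma hausdorff_pre_le_hausdorff2 d A : (0 < d)%R -> hausdorff_pre d A <= hausdorff2 A.
Proof. by move=> d0; exact: (ereal_sup_fun_ge (hausdorff_pre ^~ A)). Qed.

Lemma hausdorff_pre_antitone (d d' : R) A : (d <= d')%R ->
  hausdorff_pre d' A <= hausdorff_pre d A.
Proof.
move=> dd'; apply: ereal_inf_le_tmp => _ [C [Cd AC] <-].
by exists C => //; split => // k; rewrite (le_trans (Cd k)) // lee_fin.
Qed.

Lemma le_ediam A B : A `<=` B -> ediam A <= ediam B.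
Proof.
move=> AB; rewrite /ediam ge_max !le_max lexx /=; apply/orP; right.
apply: ereal_sup_le => _ [x Ax [y Ay <-]].
by exists x; [exact: AB|exists y; [exact: AB|]].
Qed.

Lemma ediam_ge A x y : A x -> A y -> (enorm (x - y))%:E <= ediam A.
Proof.
move=> Ax Ay; rewrite /ediam le_max; apply/orP; right.
by apply: ereal_sup_ubound; exists x => //; exists y.
Qed.

Lemma le_hausdorff_gauge A B : A `<=` B -> hausdorff_gauge A <= hausdorff_gauge B.
Proof.
move=> AB; rewrite /hausdorff_gauge lee_wpmul2l //.
  by rewrite lee_fin divr_ge0 // pi_ge0.
rewrite !expe2; apply: lee_pmul; rewrite ?ediam_ge0 ?le_ediam //.
Qed.

(** A set of diameter less than the distance of [A] and [B] cannot meet both, so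
    fine covers of the union split into covers of [A] and of [B]. *)
Lemma hausdorff_pre_separated (d h : R) A B : (d < h)%R ->
  (forall x y, A x -> B y -> (h <= enorm (x - y))%R) ->
  hausdorff_pre d A + hausdorff_pre d B <= hausdorff_pre d (A `|` B).
Proof.
move=> dh AB; apply: le_ereal_inf_tmp => _ [C [Cd ABC] <-].
have g0 D : 0 <= hausdorff_gauge D := hausdorff_gauge_ge0 D.
apply: (@le_trans _ _ (\sum_(k <oo) hausdorff_gauge (C k `&` A) +
                       \sum_(k <oo) hausdorff_gauge (C k `&` B))).
  apply: leeD; apply: ereal_inf_lbound.
    exists (fun k => C k `&` A) => //; split => [k|x Ax].
      by apply: le_trans (Cd k); apply: le_ediam => x [].
    by have [k _ Ckx] := ABC x (or_introl Ax); exists k.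
  exists (fun k => C k `&` B) => //; split => [k|x Bx].
    by apply: le_trans (Cd k); apply: le_ediam => x [].
  by have [k _ Ckx] := ABC x (or_intror Bx); exists k.
rewrite -nneseriesD //; apply: lee_nneseries => [k _ _|k _].
  exact: adde_ge0.
have [[x [Cx Ax]]|/nonemptyPn ->] := pselect (C k `&` A !=set0); last first.
  by rewrite hausdorff_gauge0 add0e le_hausdorff_gauge.
rewrite (_ : C k `&` B = set0) ?hausdorff_gauge0 ?adde0 ?le_hausdorff_gauge //.
apply/nonemptyPn => -[y [Cy By]].
have := le_trans (ediam_ge Cx Cy) (Cd k); rewrite lee_fin.
by have := AB _ _ Ax By; move: dh; clear; lra.
Qed.

Lemma hausdorff2_separated (h : R) A B : (0 < h)%R ->
  (forall x y, A x -> B y -> (h <= enorm (x - y))%R) ->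
  hausdorff2 A + hausdorff2 B <= hausdorff2 (A `|` B).
Proof.
move=> h0 AB.
have key (d1 d2 : R) : (0 < d1)%R -> (0 < d2)%R ->
    hausdorff_pre d1 A + hausdorff_pre d2 B <= hausdorff2 (A `|` B).
  move=> d10 d20; pose d := Num.min (h / 2)%R (Num.min d1 d2).
  have d0 : (0 < d)%R by rewrite /d !lt_min d10 d20 divr_gt0.
  apply: le_trans (hausdorff_pre_le_hausdorff2 _ d0).
  apply: le_trans (@hausdorff_pre_separated d h _ _ _ AB).
    by apply: leeD; apply: hausdorff_pre_antitone; rewrite /d !ge_min lexx ?orbT.
  by apply: (@le_lt_trans _ _ (h / 2)%R); [rewrite /d ge_min lexx|lra].
have [->|fin] := eqVneq (hausdorff2 (A `|` B)) +oo; first by rewrite leey.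
have pfin d X : (0 < d)%R -> X `<=` A `|` B -> hausdorff_pre d X \is a fin_num.
  move=> d0 XAB; rewrite ge0_fin_numE ?hausdorff_pre_ge0 //.
  apply: le_lt_trans (hausdorff_pre_le_hausdorff2 _ d0) _.
  by apply: le_lt_trans (le_hausdorff2 XAB) _; rewrite ltey.
have fB : hausdorff2 B \is a fin_num.
  rewrite ge0_fin_numE ?hausdorff2_ge0 //.
  by apply: le_lt_trans (le_hausdorff2 (@subsetUr _ A B)) _; rewrite ltey.
rewrite -leeBrDr //; apply: ge_ereal_sup => _ [d1 /= d10 <-].
rewrite leeBrDr // addeC -leeBrDr; last by rewrite pfin //; exact: subsetUl.
apply: ge_ereal_sup => _ [d2 /= d20 <-].
by rewrite leeBrDr ?pfin 1?addeC ?key //; exact: subsetUl.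
Qed.

End hausdorff_separated.

(** * Measurability of closed sets *)

Section caratheodory_criterion.
Context {R : realType}.
Implicit Types (A B X F : set 'rV[R]_3) (phi : 'rV[R]_3 -> R).
Local Open Scope ereal_scope.

Section layers.
Variables (phi : 'rV[R]_3 -> R) (X : set 'rV[R]_3).
Hypothesis phi_lip : forall x y, (`|phi x - phi y| <= enorm (x - y))%R.

Let layer i := X `&` [set x | (2^-1 ^+ i.+1 <= phi x < 2^-1 ^+ i)%R].

(** Layers whose indices have the same parity lie at positive distance from each
    other, so their measures add up to at most that of [X]. *)
Let sum_layers s n : \sum_(j < n) hausdorff2 (layer (2 * j + s)) <=
  hausdorff2 (X `&` [set x | (2%:R * 2^-1 ^+ (2 * n + s) <= phi x)%R]).
Proof.
elim: n => [|n IH]; first by rewrite big_ord0 hausdorff2_ge0.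
rewrite big_ord_recr /=; apply: le_trans (leeD2r _ IH) _.
set k := (2 * n + s)%N; have k0 : (0 < 2^-1 ^+ k :> R)%R by rewrite exprn_gt0.
apply: le_trans (@hausdorff2_separated _ (2^-1 ^+ k) _ _ k0 _) _.
  move=> x y [_ /= hx] [_ /= /andP[_ hy]].
  apply: le_trans (phi_lip x y); apply: le_trans (ler_norm _).
  by move: hx hy; rewrite -/k; lra.
apply: le_hausdorff2 => x.
have -> : (2 * n.+1 + s = k.+2)%N by rewrite /k mulnS -addnA add2n.
rewrite (exprS _ k.+1) mulrA divff ?pnatr_eq0 // mul1r.
move=> [[Xx /= h]|[Xx /= /andP[h _]]]; split => //=.
by move: h; rewrite -/k exprS; move: k0; lra.
Qed.

Lemma outer_layers :
  hausdorff2 (X `&` [set x | (phi x <= 0)%R]) +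
  hausdorff2 (X `&` ~` [set x | (phi x <= 0)%R]) <= hausdorff2 X.
Proof.
have [->|fin] := eqVneq (hausdorff2 X) +oo; first by rewrite leey.
(* Splitting into even and odd layers, the layers have finite total measure. *)
have sX : \sum_(k <oo) hausdorff2 (layer k) < +oo.
  apply: (@le_lt_trans _ _ (hausdorff2 X + hausdorff2 X)); last first.
    by rewrite lte_add_pinfty // ltey.
  apply: lime_le; first by apply: is_cvg_nneseries => *; exact: hausdorff2_ge0.
  near=> n => /=.
  apply: (@le_trans _ _ (\sum_(0 <= k < 2 * n) hausdorff2 (layer k))).
    have n2 : (n <= 2 * n)%N by rewrite leq_pmull.
    rewrite [leRHS](big_cat_nat (leq0n n) n2) /=.
    by rewrite leeDl // sume_ge0 // => *; exact: hausdorff2_ge0.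
  have -> : \sum_(0 <= k < 2 * n) hausdorff2 (layer k) =
      \sum_(j < n) hausdorff2 (layer (2 * j + 0)) +
      \sum_(j < n) hausdorff2 (layer (2 * j + 1)).
    rewrite -big_split /=; elim: (n) => [|m IH]; first by rewrite muln0 big_geq ?big_ord0.
    rewrite big_ord_recr /= -IH mulnS add2n !big_nat_recr //= -addeA.
    by rewrite addn0 addn1.
  by apply: leeD; apply: le_trans (sum_layers _ _) _; apply: le_hausdorff2 => x [].
have := nneseries_tail_cvg sX (fun k _ => hausdorff2_ge0 (layer k)).
move=> tail.
apply/lee_addgt0Pr => e e0.
have [N _ /(_ N (leqnn N)) /= tN] : \forall N \near \oo,
    \sum_(N <= k <oo) hausdorff2 (layer k) <= e%:E.
  have /fine_cvgP[fN /cvgrPdist_le/(_ e e0)] := tail.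
  move=> h; near=> N.
  have fN' : \sum_(N <= k <oo) hausdorff2 (layer k) \is a fin_num by near: N.
  rewrite -(fineK fN') lee_fin.
  have : (`|0 - fine (\sum_(N <= k <oo) hausdorff2 (layer k))| <= e)%R by near: N.
  by rewrite sub0r normrN; apply: le_trans; exact: ler_norm.
pose out := X `&` [set x | (2^-1 ^+ N <= phi x)%R].
have sub : X `&` ~` [set x | (phi x <= 0)%R] `<=`
    out `|` \bigcup_(k in ~` `I_N) layer k.
  move=> x [Xx /= /negP]; rewrite -ltNge => p0.
  have [h|h] := leP (2^-1 ^+ N)%R (phi x); first by left.
  right.
  have ex : exists k, (2^-1 ^+ k <= phi x)%R.
    have : (2^-1 ^+ n : R)%R @[n --> \oo] --> (0 : R)%R.
      by apply: cvg_expr; rewrite ger0_norm //; lra.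
    move=> /cvgrPdist_le/(_ _ p0)[k _ /(_ k (leqnn k)) /=].
    rewrite sub0r normrN ger0_norm ?exprn_ge0 //.
    by exists k.
  have [m Hm mmin] := ex_minnP ex.
  have Nm : (N < m)%N.
    rewrite ltnNge; apply/negP => mN; move: h; rewrite ltNge => /negP; apply.
    apply: le_trans Hm; rewrite ler_wiXn2l //; lra.
  case: m Nm Hm mmin => // m Nm Hm mmin; exists m; first by rewrite /=; apply/negP; rewrite -leqNgt.
  split => //=; rewrite Hm /= ltNge; apply/negP => /mmin; by rewrite ltnn.
apply: le_trans (leeD2l _ (le_hausdorff2 sub)) _.
apply: le_trans (leeD2l _ (outer_measureU2 hausdorff2_outer _ _)) _.
rewrite addeA; apply: leeD.
  apply: le_trans (@hausdorff2_separated _ (2^-1 ^+ N) _ _ _ _) _.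
  - by rewrite exprn_gt0.
  - move=> x y [_ /= hx] [_ /= hy].
    rewrite enormB; apply: le_trans (phi_lip y x); apply: le_trans (ler_norm _).
    by move: hx hy; lra.
  - by apply: le_hausdorff2 => x [[]|[]].
by apply: le_trans tN; exact: outer_measure_sigma_subadditive_tail.
Unshelve. all: by end_near.
Qed.

End layers.

Definition dist_set F (y : 'rV[R]_3) : R := inf [set enorm (y - x) | x in F].

Lemma dist_set_lip F x y : F !=set0 ->
  (`|dist_set F x - dist_set F y| <= enorm (x - y))%R.
Proof.
move=> [z Fz].
have lb w : has_lbound [set enorm (w - x) | x in F].
  by exists 0%R => _ [u _ <-]; exact: enorm_ge0.
have half u w : (dist_set F u - enorm (u - w) <= dist_set F w)%R.
  apply: lb_le_inf; first by exists (enorm (w - z)), z.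
  move=> _ [s Fs <-]; have := ge_inf (lb u) (ex_intro2 _ _ s Fs erefl).
  rewrite -/(dist_set F u).
  by have := enorm_tri w u s; lra.
by have := half x y; have := half y x; rewrite (enormB y x) ler_norml; lra.
Qed.

Lemma dist_set_le0 F y : closed F -> F !=set0 -> (dist_set F y <= 0)%R <-> F y.
Proof.
move=> cF [z Fz]; have lb : has_lbound [set enorm (y - x) | x in F].
  by exists 0%R => _ [u _ <-]; exact: enorm_ge0.
split=> [d0|Fy]; last first.
  have := ge_inf lb (ex_intro2 _ _ y Fy erefl).
  by rewrite subrr enorm0.
apply: cF; apply/closureP_enorm => e e0.
have [|_ [x Fx <-] xe] := @inf_adherent R [set enorm (y - x) | x in F] e e0.
  by split => //; exists (enorm (y - z)), z.
exists x => //; rewrite enormB; apply: lt_le_trans xe _.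
by move: d0; rewrite /dist_set; lra.
Qed.

(** Closed sets are Caratheodory measurable: a set [X] is exhausted outside a
    closed set by pieces at positive distance from it, up to a tail of thin
    layers of small measure. *)
Lemma closed_H2_measurable F : closed F ->
  measurable (F : set (caratheodory_type (@hausdorff2_outer R))).
Proof.
move=> cF; have [F0|/nonemptyPn ->] := pselect (F !=set0); last exact: measurable0.
apply: le_caratheodory_measurable => X.
have -> : F = [set x | (dist_set F x <= 0)%R].
  by apply/seteqP; split => x /=; rewrite dist_set_le0.
by apply: outer_layers => x y; exact: dist_set_lip.
Qed.

End caratheodory_criterion.

(** * Area and projections to planes *)

Section area_of_projection.
Context {R : realType}.
Implicit Types (A S : set 'rV[R]_3) (x y f g e : 'rV[R]_3).

Let lambda2 := (@lebesgue_measure R \x @lebesgue_measure R)%E.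

Let box (p q h : R) : set (measurableTypeR R * measurableTypeR R) :=
  `[p - h, p + h]%classic `*` `[q - h, q + h]%classic.

Let measurable_box p q h : measurable (box p q h).
Proof. by apply: measurableX; exact: measurable_itv. Qed.

Let lambda2_box p q h : 0 <= h -> lambda2 (box p q h) = (4%:R * h ^+ 2)%:E.
Proof.
move=> h0.
have L t : @lebesgue_measure R `[t - h, t + h]%classic = (2%:R * h)%:E.
  rewrite lebesgue_measure_itv /= lte_fin; case: ifPn => [_|hn].
    by rewrite -EFinB; congr EFin; ring.
  have -> : h = 0 by move: hn; rewrite -leNgt => hn; lra.
  by rewrite mulr0.
rewrite /lambda2 /box product_measure1E; try exact: measurable_itv.
transitivity ((2%:R * h)%:E * (2%:R * h)%:E)%E.
  by congr (_ * _)%E; exact: L.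
by rewrite -EFinM; congr EFin; ring.
Qed.

Lemma dotp_dist_le x y f : enorm f = 1 -> `|dotp x f - dotp y f| <= enorm (x - y).
Proof. by move=> f1; rewrite -dotpBl; have := cauchy_schwarz (x - y) f; rewrite f1 mulr1. Qed.

(** The projection of a set of diameter [D] to a plane fits into a square of side
    [2 * D], so the gauge of a cover dominates the area of the projection. *)
Lemma hausdorff2_projection_ge A f g (a b s : R) :
  enorm f = 1 -> enorm g = 1 -> 0 <= s ->
  (forall p q, `|p - a| <= s -> `|q - b| <= s ->
     exists y, [/\ A y, dotp y f = p & dotp y g = q]) ->
  ((s ^+ 2 / 4%:R)%:E <= hausdorff2 A)%E.
Proof.
move=> f1 g1 s0 hA.
apply: le_trans (hausdorff_pre_le_hausdorff2 A (@ltr01 R)).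
apply: le_ereal_inf_tmp => _ [C [Cd AC] <-].
have cfin k : ediam (C k) \is a fin_num.
  by rewrite ge0_fin_numE ?ediam_ge0 //; apply: le_lt_trans (Cd k) _; rewrite ltey.
pose D k := fine (ediam (C k)).
have DE k : (D k)%:E = ediam (C k) by rewrite /D fineK.
have D0 k : 0 <= D k by rewrite -lee_fin DE ediam_ge0.
pose B k : set (measurableTypeR R * measurableTypeR R) :=
  if pselect (C k !=set0) is left h then
    box (dotp (projT1 (cid h)) f) (dotp (projT1 (cid h)) g) (D k)
  else set0.
have mB k : measurable (B k).
  by rewrite /B; case: pselect => // h; exact: measurable0.
have lB k : (lambda2 (B k) <= 16%:R%:E * hausdorff_gauge (C k))%E.
  rewrite /B; case: pselect => [h|_]; last first.
    rewrite (_ : lambda2 set0 = 0%E); last exact: measure0.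
    apply: mule_ge0 => //; exact: hausdorff_gauge_ge0.
  rewrite lambda2_box // /hausdorff_gauge -DE -EFin_expe -!EFinM lee_fin.
  have := pi_ge2 R; have := sqr_ge0 (D k) => h2 hp.
  have := mulr_ge0 h2 (_ : 0 <= pi - 1); rewrite subr_ge0 => /(_ _); lra.
have cov : box a b s `<=` \bigcup_k B k.
  move=> [p q] [/=]; rewrite !in_itv /= => hp hq.
  have [||y [Ay yp yq]] := hA p q; [rewrite ler_norml; lra..|].
  have [k _ Cky] := AC y Ay; exists k => //.
  rewrite /B; case: pselect => [h|]; last by case; exists y.
  case: (cid h) => z Cz /=.
  have yz : enorm (y - z) <= D k by rewrite -lee_fin DE; exact: ediam_ge.
  have := dotp_dist_le y z f1; have := dotp_dist_le y z g1.
  by rewrite yp yq /box /= !in_itv /= !ler_norml; split => /=; lra.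
have := measure_sigma_subadditive lambda2 mB (measurable_box a b s) cov.
move=> h1.
have : ((4%:R * s ^+ 2)%:E <= 16%:R%:E * \sum_(k <oo) hausdorff_gauge (C k))%E.
  rewrite -(lambda2_box a b s0).
  apply: le_trans h1 _; rewrite -nneseriesZl => [|k _]; last exact: hausdorff_gauge_ge0.
  by apply: lee_nneseries.
move=> h2; rewrite -(@lee_pmul2l _ 16%:R%:E) ?lte_fin //.
by apply: le_trans h2; rewrite -EFinM lee_fin; lra.
Qed.

(** Both Lipschitz graphs and two-sided flat sets satisfy this quantitative form of
    being two-dimensional, the former with a constant [c] that depends on the
    Lipschitz constant; it provides area as well as points in general position. *)
Definition big_projection c S x r := exists2 e, enorm e = 1 &
  forall v, dotp v e = 0 -> enorm v <= c * r ->
    exists2 t, S (x + v + t *: e) & enorm (v + t *: e) <= r.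

Lemma big_projection_mass c S x r : 0 <= c -> 0 <= r -> big_projection c S x r ->
  (((c * r) ^+ 2 / 16%:R)%:E <= hausdorff2 (S `&` [set y | enorm (y - x) <= r]%R))%E.
Proof.
move=> c0 r0 [e e1 he].
have [f [g [f1 g1 fe ge [fg _]]]] := orthonormal_complement e1.
have cr0 : 0 <= c * r / 2%:R by rewrite divr_ge0 // mulr_ge0.
apply: le_trans (hausdorff2_projection_ge (a := dotp x f) (b := dotp x g) f1 g1 cr0 _).
  by rewrite lee_fin; have := sqr_ge0 (c * r); lra.
move=> p q hp hq.
pose v := (p - dotp x f) *: f + (q - dotp x g) *: g.
have ff : dotp f f = 1 by rewrite -sqr_enorm f1 expr1n.
have gg : dotp g g = 1 by rewrite -sqr_enorm g1 expr1n.
have [||t St rt] := he v.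
- by rewrite /v dotpDl !dotpZl fe ge; ring.
- apply: le_trans (enormD _ _) _; rewrite !enormZ f1 g1; lra.
exists (x + v + t *: e); split.
- split => //=; rewrite (_ : _ - x = v + t *: e) //.
  by apply: row3P; rewrite !coordE; ring.
- by rewrite /v !dotp_lin (dotpC e) (dotpC g) fe ff fg; ring.
- by rewrite /v !dotp_lin (dotpC e) ge gg fg; ring.
Qed.

End area_of_projection.

(** * Planes and their normals *)

Section planes_and_normals.
Context {R : realType}.
Implicit Types (P : {vspace 'rV[R]_3}) (u v w n : 'rV[R]_3).

Lemma cross_eq0_colinear u v : u != 0 -> cross u v = 0 ->
  v = (dotp u v / dotp u u) *: u.
Proof.
move=> u0 uv; have uu : dotp u u != 0 by apply: contra u0 => /eqP/dotp_eq0 ->.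
have : cross u (cross u v) = 0.
  by rewrite uv; apply: row3P; rewrite !coordE; ring.
rewrite cross_cross => /subr0_eq h.
by rewrite mulrC -scalerA h scalerA mulVf // scale1r.
Qed.

Lemma orthogonal_cross_span u v w : dotp w (cross u v) = 0 ->
  dotp (cross u v) (cross u v) *: w =
  (dotp w v * dotp u u - dotp w u * dotp u v) *: v -
  (dotp w v * dotp u v - dotp w u * dotp v v) *: u.
Proof.
move=> h; have -> : dotp (cross u v) (cross u v) *: w =
    cross (cross u v) (cross w (cross u v)) + dotp w (cross u v) *: cross u v.
  by rewrite (cross_cross (cross u v)) (dotpC _ w) subrK.
rewrite h scale0r addr0 (cross_cross w).
by apply: row3P; rewrite !coordE; ring.
Qed.

(** The cross product of a basis of [P] is orthogonal to [P], and a vector orthogonal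
    to it is a combination of the basis by the formula for double cross products. *)
Lemma plane_normal P : \dim P = 2%N ->
  exists2 n, enorm n = 1 & forall v, v \in P <-> dotp v n = 0.
Proof.
move=> dP; have := vbasisP P.
have : size (vbasis P) = 2 by rewrite size_tuple dP.
move: (tval (vbasis P)) => [//|u [//|v [|//]]] _ /andP[/eqP sP fP].
move: fP; rewrite free_cons seq1_free => /andP[uv v0].
have N0 : cross v u != 0.
  apply: contra uv => /eqP/(cross_eq0_colinear v0) ->.
  by rewrite span_seq1; apply: memvZ; exact: memv_line.
have uP : u \in P by rewrite -sP; apply: memv_span; rewrite !inE eqxx.
have vP : v \in P by rewrite -sP; apply: memv_span; rewrite !inE eqxx orbT.
exists ((enorm (cross v u))^-1 *: cross v u).
  by apply: enorm_cross_gt0_unit; exact: enorm_gt0.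
move=> w; rewrite dotpZr; split.
  rewrite -sP span_cons span_seq1 => /memv_addP[_ /vlineP[a ->]] [_ /vlineP[b ->] ->].
  by rewrite dotpDl !dotpZl cross_dotl cross_dotr; ring.
move=> /eqP; rewrite mulf_eq0 invr_eq0 => /orP[/eqP/enorm_eq0/eqP|/eqP h].
  by rewrite (negbTE N0).
have := orthogonal_cross_span h; set d := dotp _ _ => hd.
have d0 : d != 0 by apply: contra N0 => /eqP/dotp_eq0 ->.
have -> : w = d^-1 *: (d *: w) by rewrite scalerA mulVf // scale1r.
by rewrite hd; apply: memvZ; apply: memvB; apply: memvZ.
Qed.

Lemma normal_plane n : enorm n = 1 ->
  exists2 P, \dim P = 2%N & forall v, v \in P <-> dotp v n = 0.
Proof.
move=> n1; have [f [g [f1 g1 fn gn [fg fgn]]]] := orthonormal_complement n1.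
have ff : dotp f f = 1 by rewrite -sqr_enorm f1 expr1n.
have gg : dotp g g = 1 by rewrite -sqr_enorm g1 expr1n.
exists <<[:: f; g]>>%VS.
  suff /eqP -> : free [:: f; g] by [].
  rewrite free_cons seq1_free; apply/andP; split; last first.
    by apply: contraTneq isT => g0; move: gg; rewrite g0 dotp0l => /eqP; rewrite eq_sym oner_eq0.
  apply/negP; rewrite span_seq1 => /vlineP[a fa].
  move: ff; rewrite fa dotpZl dotpZr gg; move: fg; rewrite fa dotpZl gg mulr1.
  by move=> ->; rewrite mul0r => /eqP; rewrite eq_sym oner_eq0.
move=> w; split.
  rewrite span_cons span_seq1 => /memv_addP[_ /vlineP[a ->]] [_ /vlineP[b ->] ->].
  by rewrite dotpDl !dotpZl fn gn; ring.
move=> wn; have := @orthogonal_cross_span f g w.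
rewrite fgn wn -sqr_enorm n1 expr1n scale1r => /(_ erefl) ->.
by apply: memvB; apply: memvZ; apply: memv_span; rewrite !inE eqxx ?orbT.
Qed.

End planes_and_normals.

(** * Lower bounds for the Menger curvature and its energy *)

Section menger_lower_bound.
Context {R : realType}.
Implicit Types (x y z u v w n : 'rV[R]_3).

Lemma orthogonal_tdet n u v w : enorm n = 1 -> dotp u n = 0 -> dotp v n = 0 ->
  dotp w n = 0 -> tdet u v w = 0.
Proof.
move=> n1 un vn wn.
have : tdet u v w *: n = dotp u n *: cross v w + dotp v n *: cross w u +
                         dotp w n *: cross u v.
  by apply: row3P; rewrite /tdet !coordE; ring.
rewrite un vn wn !scale0r !addr0 => h.
have := sqr_enorm n; rewrite n1 expr1n => nn.
by rewrite -[tdet _ _ _]mulr1 nn -dotpZl h dotp0l.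
Qed.

Lemma coplanar_tdet x0 x1 x2 x3 : coplanar x0 x1 x2 x3 ->
  tdet (x1 - x0) (x2 - x0) (x3 - x0) = 0.
Proof.
move=> [P dP [h1 h2 h3]]; have [n n1 hn] := plane_normal dP.
by apply: (orthogonal_tdet n1); apply/hn.
Qed.

Lemma triangle_area_le x y z (d : R) : 0 <= d -> enorm (x - y) <= d ->
  enorm (x - z) <= d -> triangle_area x y z <= d ^+ 2 / 2%:R.
Proof.
move=> d0 xy xz; rewrite /triangle_area ler_pM2r ?invr_gt0 //.
rewrite -[leRHS]ger0_norm ?sqr_ge0 // -sqrtr_sqr ler_sqrt ?sqr_ge0 //.
rewrite -!sqr_enorm (enormB y) (enormB z) (exprS _ 1) expr1.
apply: (@le_trans _ _ (enorm (x - y) ^+ 2 * enorm (x - z) ^+ 2)).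
  by rewrite gerBl sqr_ge0.
by apply: ler_pM; rewrite ?sqr_ge0 // ler_pXn2r ?nnegrE ?enorm_ge0.
Qed.

Lemma triangle_area_ge0 x y z : 0 <= triangle_area x y z.
Proof. by rewrite /triangle_area divr_ge0 // sqrtr_ge0. Qed.

Lemma menger_curvature_ge0 x0 x1 x2 x3 : 0 <= menger_curvature x0 x1 x2 x3.
Proof.
rewrite /menger_curvature; case: ifP => // _; rewrite divr_ge0 //.
  by rewrite /tetra_volume divr_ge0.
by rewrite mulr_ge0 ?sqr_ge0 // /tetra_area !addr_ge0 ?triangle_area_ge0.
Qed.

Lemma menger_curvature_ge x0 x1 x2 x3 (d v : R) : 0 < v ->
  enorm (x0 - x1) <= d -> enorm (x0 - x2) <= d -> enorm (x0 - x3) <= d ->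
  enorm (x1 - x2) <= d -> enorm (x1 - x3) <= d -> enorm (x2 - x3) <= d ->
  v <= `|tdet (x1 - x0) (x2 - x0) (x3 - x0)| ->
  v / (12%:R * d ^+ 4) <= menger_curvature x0 x1 x2 x3.
Proof.
move=> v0 h01 h02 h03 h12 h13 h23 hv.
have d0 : 0 <= d by apply: le_trans h01; exact: enorm_ge0.
rewrite /menger_curvature; case: ifPn => [/asboolP/coplanar_tdet h|_].
  by move: hv; rewrite h normr0 leNgt v0.
rewrite /tetra_volume det_tdet.
set D := tetra_diam _ _ _ _; set A := tetra_area _ _ _ _.
have Dd : D <= d.
  rewrite /D /tetra_diam !big_cons !big_nil !ge_max !subrr !enorm0.
  rewrite (enormB x1 x0) (enormB x2 x0) (enormB x3 x0) (enormB x2 x1).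
  by rewrite (enormB x3 x1) (enormB x3 x2) h01 h02 h03 h12 h13 h23 d0.
have Ad : A <= 2%:R * d ^+ 2.
  have a1 := triangle_area_le d0 h12 h13; have a2 := triangle_area_le d0 h02 h03.
  have a3 := triangle_area_le d0 h01 h03; have a4 := triangle_area_le d0 h01 h02.
  by rewrite /A /tetra_area; lra.
have vc : v <= enorm (cross (x1 - x0) (x2 - x0)) * enorm (x3 - x0).
  by apply: le_trans hv _; exact: cauchy_schwarz.
have c0 : 0 < enorm (cross (x1 - x0) (x2 - x0)).
  rewrite lt_def enorm_ge0 andbT; apply: contraTneq v0 => c0.
  by move: vc; rewrite c0 mul0r -leNgt.
have u0 : 0 < enorm (x0 - x1).
  rewrite lt_def enorm_ge0 andbT; apply: contraTneq c0 => u0.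
  have := enorm_cross_le (x1 - x0) (x2 - x0).
  by rewrite (enormB x1) u0 mul0r -leNgt.
have D0 : 0 < D.
  apply: lt_le_trans u0 _.
  by rewrite /D /tetra_diam !big_cons !big_nil !le_max lexx ?orbT.
have A0 : 0 < A.
  rewrite /A /tetra_area; apply: ltr_wpDl.
    by rewrite !addr_ge0 ?triangle_area_ge0.
  rewrite /triangle_area divr_gt0 // sqrtr_gt0 -!sqr_enorm -exprMn -sqr_cross.
  by rewrite exprn_gt0.
rewrite ler_pdivlMr ?mulr_gt0 ?exprn_gt0 //.
have d0' : 0 < d by apply: lt_le_trans D0 Dd.
have AD : A * D ^+ 2 <= 2%:R * d ^+ 2 * d ^+ 2.
  apply: ler_pM; rewrite ?sqr_ge0 ?(ltW A0) //.
  by rewrite ler_pXn2r ?nnegrE // ltW.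
apply: (@le_trans _ _ (v / 6%:R)); last by rewrite ler_pM2r.
rewrite mulrAC ler_pdivrMr ?mulr_gt0 ?exprn_gt0 //.
apply: le_trans (ler_wpM2l (ltW v0) AD) _.
by rewrite (_ : v / 6%:R * _ = v * (2%:R * d ^+ 2 * d ^+ 2)) //; field.
Qed.

Lemma integral_menger_ge (p : R) (S A0 A1 A2 A3 : set 'rV[R]_3) (k m : R) :
  0 <= p -> 0 <= k -> 0 <= m ->
  closed A0 -> closed A1 -> closed A2 -> closed A3 ->
  A0 `<=` S -> A1 `<=` S -> A2 `<=` S -> A3 `<=` S ->
  (m%:E <= hausdorff2 A0)%E -> (m%:E <= hausdorff2 A1)%E ->
  (m%:E <= hausdorff2 A2)%E -> (m%:E <= hausdorff2 A3)%E ->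
  (forall x0 x1 x2 x3, A0 x0 -> A1 x1 -> A2 x2 -> A3 x3 ->
     k <= menger_curvature x0 x1 x2 x3) ->
  ((k `^ p * m ^+ 4)%:E <= integral_menger p S)%E.
Proof.
move=> p0 k0 m0 c0 c1 c2 c3 s0 s1 s2 s3 h0 h1 h2 h3 hk.
have kp : 0 <= k `^ p by exact: powR_ge0.
have i3 x1 x2 x3 : A1 x1 -> A2 x2 -> A3 x3 -> ((k `^ p * m)%:E <=
    \int[H2]_(x0 in S) (menger_curvature x0 x1 x2 x3 `^ p)%:E)%E.
  move=> a1 a2 a3; apply: (@integral_ge_cst R _ (caratheodory_type (@hausdorff2_outer R)) H2 S A0) => //.
  - exact: closed_H2_measurable.
  - by move=> x _; rewrite lee_fin powR_ge0.
  - move=> x0 a0; rewrite lee_fin ge0_ler_powR ?nnegrE ?menger_curvature_ge0 //.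
    exact: hk.
have i2 x2 x3 : A2 x2 -> A3 x3 -> ((k `^ p * m * m)%:E <=
    \int[H2]_(x1 in S) \int[H2]_(x0 in S) (menger_curvature x0 x1 x2 x3 `^ p)%:E)%E.
  move=> a2 a3; apply: (@integral_ge_cst R _ (caratheodory_type (@hausdorff2_outer R)) H2 S A1) => //.
  - exact: closed_H2_measurable.
  - by rewrite mulr_ge0.
  - by move=> x1 _; apply: integral_ge0 => x _; rewrite lee_fin powR_ge0.
  - by move=> x1 a1; exact: i3.
have i1 x3 : A3 x3 -> ((k `^ p * m * m * m)%:E <=
    \int[H2]_(x2 in S) \int[H2]_(x1 in S) \int[H2]_(x0 in S)
      (menger_curvature x0 x1 x2 x3 `^ p)%:E)%E.
  move=> a3; apply: (@integral_ge_cst R _ (caratheodory_type (@hausdorff2_outer R)) H2 S A2) => //.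
  - exact: closed_H2_measurable.
  - by rewrite !mulr_ge0.
  - move=> x2 _; apply: integral_ge0 => x1 _; apply: integral_ge0 => x _.
    by rewrite lee_fin powR_ge0.
  - by move=> x2 a2; exact: i2.
rewrite (_ : _ * m ^+ 4 = k `^ p * m * m * m * m); last by ring.
apply: (@integral_ge_cst R _ (caratheodory_type (@hausdorff2_outer R)) H2 S A3) => //.
- exact: closed_H2_measurable.
- by rewrite !mulr_ge0.
- move=> x3 _; apply: integral_ge0 => x2 _; apply: integral_ge0 => x1 _.
  by apply: integral_ge0 => x _; rewrite lee_fin powR_ge0.
Qed.

End menger_lower_bound.

(** * Finite energy forces flatness *)

Section flatness.
Context {R : realType}.
Implicit Types (x y z u v w n : 'rV[R]_3) (S : set 'rV[R]_3) (c r p E : R).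

Lemma big_projection_frame c S x r : 0 < c -> 0 < r -> big_projection c S x r ->
  exists u v, [/\ S (x + u) /\ S (x + v), enorm u <= r, enorm v <= r &
                  c ^+ 2 * r ^+ 2 <= enorm (cross u v)].
Proof.
move=> c0 r0 [e e1 he]; have [f [g [f1 g1 fe ge [_ fg]]]] := orthonormal_complement e1.
have cr : 0 < c * r by rewrite mulr_gt0.
have [||t Sf tf] := he ((c * r) *: f).
- by rewrite dotpZl fe mulr0.
- by rewrite enormZ f1 mulr1 gtr0_norm.
have [||t' Sg tg] := he ((c * r) *: g).
- by rewrite dotpZl ge mulr0.
- by rewrite enormZ g1 mulr1 gtr0_norm.
exists ((c * r) *: f + t *: e), ((c * r) *: g + t' *: e).
rewrite !addrA; split => //.
have <- : dotp (cross ((c * r) *: f + t *: e) ((c * r) *: g + t' *: e)) e =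
    c ^+ 2 * r ^+ 2.
  transitivity ((c * r) ^+ 2 * dotp (cross f g) e); first by rewrite !coordE; ring.
  by rewrite fg -sqr_enorm e1; ring.
apply: le_trans (ler_norm _) _.
by have := cauchy_schwarz (cross ((c * r) *: f + t *: e) ((c * r) *: g + t' *: e)) e;
  rewrite e1 mulr1.
Qed.

(** If a tetrahedron of size [r] has volume [b * r ^ 3 / 6], then half of the volume
    remains if all vertices move by [b * r / 100]. This constant is what is left
    of the energy of these tetrahedra when the powers of [b] and [r] are removed:
    the first factor comes from the curvature, the second from the areas of the
    four balls. *)
Definition energy_const p c : R :=
  (24%:R * 4%:R ^+ 4)^-1 `^ p * (c ^+ 2 / (16%:R * 100%:R ^+ 2)) ^+ 4.

(** The bound that the energy imposes on the relative thickness of the surface at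
    scale [r]. It depends on the scale only through the quantity
    [E * r ^ (p - 8)], which is invariant under dilations. *)
Definition flatness p c E r :=
  (E * r `^ (p - 8%:R) / energy_const p c) `^ (p + 8%:R)^-1 / c ^+ 2.

Lemma energy_const_gt0 p c : 0 < c -> 0 < energy_const p c.
Proof.
by move=> c0; rewrite /energy_const mulr_gt0 ?powR_gt0 ?exprn_gt0 ?divr_gt0 ?invr_gt0
  ?mulr_gt0 ?exprn_gt0.
Qed.

Lemma energy_power_bound p c (b r E : R) : 8%:R < p -> 0 < c -> 0 < b -> 0 < r ->
  (b / (24%:R * 4%:R ^+ 4 * r)) `^ p * ((c * (b * r / 100%:R)) ^+ 2 / 16%:R) ^+ 4 <= E ->
  b <= (E * r `^ (p - 8%:R) / energy_const p c) `^ (p + 8%:R)^-1.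
Proof.
move=> p8 c0 b0 r0 h.
have p80 : 0 < p + 8%:R by lra.
have k0 := energy_const_gt0 p c0.
have bp : b `^ (p + 8%:R) <= E * r `^ (p - 8%:R) / energy_const p c.
  rewrite ler_pdivlMr //.
  have rp : 0 < r `^ (p - 8%:R) by exact: powR_gt0.
  apply: le_trans (ler_wpM2r (ltW rp) h); rewrite le_eqVlt; apply/orP; left.
  apply/eqP; set K := 24%:R * _; have K0 : 0 < K by rewrite mulr_gt0 ?exprn_gt0.
  have -> : b / (K * r) = b * (K^-1 * r^-1) by rewrite invfM.
  rewrite !powRM ?mulr_ge0 ?invr_ge0 ?(ltW b0) ?(ltW r0) ?(ltW K0) //.
  rewrite /energy_const -/K powRD; last by apply/implyP => _; rewrite gt_eqF.
  rewrite (_ : r^-1 `^ p = (r `^ p)^-1); last first.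
    by rewrite -powR_inv1 ?(ltW r0) // -powRrM mulN1r powRN.
  have -> : r `^ p = r `^ (p - 8%:R) * r ^+ 8.
    rewrite -powR_mulrn ?(ltW r0) // -powRD ?subrK //.
    by apply/implyP => _; rewrite gt_eqF.
  rewrite powR_mulrn ?(ltW b0) //.
  have rn : r != 0 by rewrite gt_eqF.
  have rpn : r `^ (p - 8%:R) != 0 by rewrite gt_eqF.
  by field; rewrite ?rn ?rpn.
have -> : b = (b `^ (p + 8%:R)) `^ (p + 8%:R)^-1.
  by rewrite -powRrM divff ?gt_eqF // powRr1 // ltW.
rewrite ge0_ler_powR ?nnegrE ?powR_ge0 ?invr_ge0 ?(ltW p80) //.
by apply: le_trans bp; exact: powR_ge0.
Qed.

(** If some point of [S] were far from the plane spanned by [x] and the two points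
    that the big projection provides, then all tetrahedra with vertices close to
    these four points would have large curvature, and since every such
    neighbourhood carries a definite amount of area, the energy would be large. *)
Lemma flat_of_energy p c E S x r : 8%:R < p -> 0 < c -> 0 < r -> closed S ->
  (integral_menger p S <= E%:E)%E -> S x ->
  (forall y s, S y -> enorm (y - x) <= 2%:R * r -> 0 < s -> s <= r ->
     big_projection c S y s) ->
  exists2 n, enorm n = 1 & forall y, S y -> enorm (y - x) <= 2%:R * r ->
    `|dotp (y - x) n| <= flatness p c E r * r.
Proof.
rewrite /flatness => p8 c0 r0 cS SE Sx bpS.
have [|u [v [[Su Sv] ur vr uvr]]] := @big_projection_frame c S x r c0 r0.
  by apply: bpS => //; rewrite subrr enorm0 mulr_ge0 // ltW.
have c2 : 0 < c ^+ 2 by rewrite exprn_gt0.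
have N0 : 0 < enorm (cross u v).
  by apply: lt_le_trans uvr; rewrite mulr_gt0 ?exprn_gt0.
exists ((enorm (cross u v))^-1 *: cross u v); first exact: enorm_cross_gt0_unit.
move=> y Sy yr; set w := y - x in yr *.
rewrite dotpZr dotpC -/(tdet u v w) normrM gtr0_norm ?invr_gt0 //.
(* [b] is the volume of the parallelepiped relative to the scale. *)
set D := `|tdet u v w|; pose b := D / r ^+ 3.
have r3 : 0 < r ^+ 3 by rewrite exprn_gt0.
have DE : D = b * r ^+ 3 by rewrite /b divfK ?gt_eqF.
suff hb : b <= (E * r `^ (p - 8%:R) / energy_const p c) `^ (p + 8%:R)^-1.
  rewrite ler_pdivrMl //; set B := _ `^ _ in hb *.
  have B0 : 0 <= B by exact: powR_ge0.
  apply: le_trans (ler_wpM2r _ uvr); last first.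
    by rewrite mulr_ge0 ?(ltW r0) // divr_ge0 // ltW.
  rewrite DE (_ : _ * (B / _ * r) = B * r ^+ 3); first by rewrite ler_wpM2r // ltW.
  by field; rewrite gt_eqF.
have D0 : 0 <= D := normr_ge0 _.
have [b0|b0] := leP b 0; first by apply: le_trans b0 (powR_ge0 _ _).
have b2 : b <= 2%:R.
  rewrite /b ler_pdivrMr //; apply: le_trans (tdet_le _ _ _) _.
  have := ler_pM (enorm_ge0 u) (enorm_ge0 v) ur vr => uv.
  have := ler_pM (mulr_ge0 (enorm_ge0 u) (enorm_ge0 v)) (enorm_ge0 w) uv yr.
  by rewrite (_ : r * r * (2%:R * r) = 2%:R * r ^+ 3) //; ring.
apply: energy_power_bound => //.
set d := b * r / 100%:R.
have d0 : 0 < d by rewrite /d divr_gt0 // mulr_gt0.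
have dr : d <= r / 50%:R.
  have := ler_wpM2r (ltW r0) b2; rewrite /d; lra.
rewrite -lee_fin; apply: le_trans SE.
pose A z := S `&` [set y | enorm (y - z) <= d].
have cA z : closed (A z) by apply: closedI => //; exact: closed_eball.
have AS z : A z `<=` S by move=> ? [].
have mA z : S z -> enorm (z - x) <= 2%:R * r ->
    (((c * d) ^+ 2 / 16%:R)%:E <= hausdorff2 (A z))%E.
  move=> Sz zx; apply: big_projection_mass; rewrite ?(ltW c0) ?(ltW d0) //.
  by apply: bpS => //; lra.
have xuE z : x + z - x = z by rewrite addrC addKr.
apply: (integral_menger_ge (A0 := A x) (A1 := A (x + u)) (A2 := A (x + v)) (A3 := A y)) => //.
- lra.
- apply: divr_ge0; first exact: ltW.
  by apply: mulr_ge0 (ltW r0); rewrite mulr_ge0 ?exprn_ge0.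
- by rewrite divr_ge0 ?sqr_ge0.
- by apply: mA => //; rewrite subrr enorm0; lra.
- by apply: mA => //; rewrite xuE; lra.
- by apply: mA => //; rewrite xuE; lra.
- exact: mA.
move=> x0 x1 x2 x3 [_ /= h0] [_ /= h1] [_ /= h2] [_ /= h3].
have bnd a a' z z' l : enorm (a - z) <= d -> enorm (a' - z') <= d ->
    enorm (z - z') <= l -> enorm (a - a') <= l + 2%:R * d.
  move=> az az' zz; have := enorm_tri z a a'; have := enorm_tri z' z a'.
  by move: az'; rewrite (enormB a'); lra.
have xu : enorm (x - (x + u)) <= r by rewrite enormB xuE.
have xv : enorm (x - (x + v)) <= r by rewrite enormB xuE.
have xy : enorm (x - y) <= 2%:R * r by rewrite enormB.
have uv : enorm (x + u - (x + v)) <= 2%:R * r.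
  by have := enorm_tri x (x + u) (x + v); rewrite xuE; lra.
have uy : enorm (x + u - y) <= 3%:R * r.
  by have := enorm_tri x (x + u) y; rewrite xuE; lra.
have vy : enorm (x + v - y) <= 3%:R * r.
  by have := enorm_tri x (x + v) y; rewrite xuE; lra.
rewrite (_ : b / (24%:R * 4%:R ^+ 4 * r) = (b * r ^+ 3 / 2%:R) / (12%:R * (4%:R * r) ^+ 4));
  last by field; rewrite gt_eqF.
have b01 := bnd _ _ _ _ _ h0 h1 xu; have b02 := bnd _ _ _ _ _ h0 h2 xv.
have b03 := bnd _ _ _ _ _ h0 h3 xy; have b12 := bnd _ _ _ _ _ h1 h2 uv.
have b13 := bnd _ _ _ _ _ h1 h3 uy; have b23 := bnd _ _ _ _ _ h2 h3 vy.
have le4 (l t : R) : l <= 3%:R -> t <= l * r + 2%:R * d -> t <= 4%:R * r.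
  move=> l3 tl; have := ler_wpM2r (ltW r0) l3; clear - tl dr r0; lra.
apply: menger_curvature_ge.
- by rewrite divr_gt0 // mulr_gt0.
- by apply: (le4 1); [clear; lra|rewrite mul1r].
- by apply: (le4 1); [clear; lra|rewrite mul1r].
- by apply: (le4 2%:R); [clear; lra|].
- by apply: (le4 2%:R); [clear; lra|].
- by apply: (le4 3%:R).
- by apply: (le4 3%:R).
have diff z z' : enorm (z' - z) <= d -> enorm ((z' - x0) - (z - x)) <= 2%:R * d.
  move=> zz; have -> : z' - x0 - (z - x) = (z' - z) - (x0 - x).
    by apply: row3P; rewrite !coordE; ring.
  by apply: le_trans (enormBD _ _) _; clear - zz h0; lra.
(* By multilinearity the volume changes by at most [20 * d * r ^ 2], a fifth of it. *)
have := tdetB u v w (x1 - x0) (x2 - x0) (x3 - x0).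
set u' := x1 - x0; set v' := x2 - x0; set w' := x3 - x0.
have du : enorm (u' - u) <= 2%:R * d by have := diff _ _ h1; rewrite xuE.
have dv : enorm (v' - v) <= 2%:R * d by have := diff _ _ h2; rewrite xuE.
have dw : enorm (w' - w) <= 2%:R * d by have := diff _ _ h3.
have v'2 : enorm v' <= 2%:R * r by rewrite /v' enormB; clear - b02 dr r0; lra.
have w'3 : enorm w' <= 3%:R * r by rewrite /w' enormB; clear - b03 dr r0; lra.
have mono3 (a a' b' b'' e e' : R) : 0 <= a -> 0 <= b' -> 0 <= e -> a <= a' ->
    b' <= b'' -> e <= e' -> a * b' * e <= a' * b'' * e'.
  by move=> *; apply: ler_pM; rewrite ?mulr_ge0 //; apply: ler_pM.
have t1 : `|tdet (u' - u) v' w'| <= 2%:R * d * (2%:R * r) * (3%:R * r).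
  by apply: le_trans (tdet_le _ _ _) _; apply: mono3; rewrite ?enorm_ge0.
have t2 : `|tdet u (v' - v) w'| <= r * (2%:R * d) * (3%:R * r).
  by apply: le_trans (tdet_le _ _ _) _; apply: mono3; rewrite ?enorm_ge0.
have t3 : `|tdet u v (w' - w)| <= r * r * (2%:R * d).
  by apply: le_trans (tdet_le _ _ _) _; apply: mono3; rewrite ?enorm_ge0.
have dE : d * r * r = b * r ^+ 3 / 100%:R by rewrite /d; ring.
move=> /eqP; rewrite subr_eq => /eqP ->.
move: DE t1 t2 t3; rewrite /D => DE t1 t2 t3.
have := ler_normB (tdet (u' - u) v' w' + tdet u (v' - v) w' + tdet u v (w' - w) +
  tdet u v w) (tdet (u' - u) v' w' + tdet u (v' - v) w' + tdet u v (w' - w)).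
rewrite [X in `|X| <= _](_ : _ = tdet u v w); last by ring.
have := ler_normD (tdet (u' - u) v' w' + tdet u (v' - v) w') (tdet u v (w' - w)).
have := ler_normD (tdet (u' - u) v' w') (tdet u (v' - v) w').
have b3 : 0 < b * r ^+ 3 by rewrite mulr_gt0.
clear - b3 dE DE t1 t2 t3; lra.
Qed.

End flatness.

(** * Two-sided flatness *)

Section two_sided_flatness.
Context {R : realType}.
Variable U : set 'rV[R]_3.
Hypothesis oU : open U.
Let S := boundary U.
Implicit Types (x y z u v w n e : 'rV[R]_3) (h r s t : R).

Definition slab n x r h := forall y, S y -> enorm (y - x) <= r ->
  `|dotp (y - x) n| <= h.

Lemma slabN n x r h : slab n x r h -> slab (- n) x r h.
Proof. by move=> sl y Sy yr; rewrite dotpNr normrN; exact: sl. Qed.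

Lemma slab_avoids n x r h a b : slab n x r h ->
  enorm (a - x) <= r -> enorm (b - x) <= r ->
  h < dotp (a - x) n -> h < dotp (b - x) n -> avoids S a b.
Proof.
move=> sl ar br ah bh t t01 St.
have := sl _ St (ray_ball_le t01 ar br).
have E c : dotp (c - x) n = dotp c n - dotp x n by rewrite dotpBl.
rewrite leNgt => /negP; apply; apply: lt_le_trans (ler_norm _).
have ah' : h + dotp x n < dotp a n by move: ah; rewrite E; lra.
have bh' : h + dotp x n < dotp b n by move: bh; rewrite E; lra.
by have := ray_halfspace_gt t01 ah' bh'; rewrite E; lra.
Qed.

(** The tolerance [1 / 20] is small enough for the normals of consecutive scales
    to be close to each other. *)
Definition flat_two_sided x r := exists2 n, enorm n = 1 &
  [/\ slab n x r (r / 20%:R), U (x + (r / 2%:R) *: n) &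
      ~ closure U (x - (r / 2%:R) *: n)].

Lemma subDK x u : x + u - x = u. Proof. by rewrite addrC addKr. Qed.

Lemma subDDK x u w : x + u + w - x = u + w.
Proof. by rewrite -(addrA x) subDK. Qed.

Lemma enorm_orthogonal_le n v t r : enorm n = 1 -> dotp v n = 0 ->
  0 <= r -> enorm v <= r / 2%:R -> `|t| <= r / 2%:R -> enorm (v + t *: n) <= r.
Proof.
move=> n1 vn r0 vr tr; rewrite -(ler_pXn2r (n := 2)) ?nnegrE ?enorm_ge0 //.
rewrite pythagoras // -(real_normK (num_real t)).
have r2 : 0 <= r / 2%:R by rewrite divr_ge0.
have h1 : enorm v ^+ 2 <= (r / 2%:R) ^+ 2 by rewrite ler_pXn2r ?nnegrE ?enorm_ge0.
have h2 : `|t| ^+ 2 <= (r / 2%:R) ^+ 2 by rewrite ler_pXn2r ?nnegrE.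
have := sqr_ge0 r; lra.
Qed.

(** The two caps of the ball outside the slab lie on different sides of the
    surface, so every segment orthogonal to the slab that joins them crosses the
    surface, and it can do so only inside the slab. *)
Lemma flat_two_sided_crossing n x r v : 0 < r -> enorm n = 1 ->
  slab n x r (r / 20%:R) -> U (x + (r / 2%:R) *: n) ->
  ~ closure U (x - (r / 2%:R) *: n) -> dotp v n = 0 -> enorm v <= r / 2%:R ->
  exists t, [/\ `|t| <= r / 20%:R, S (x + v + t *: n) & enorm (v + t *: n) <= r].
Proof.
move=> r0 n1 sl Un nUn vn vr.
have nn : dotp n n = 1 by rewrite -sqr_enorm n1 expr1n.
have b (w : 'rV[R]_3) t : dotp w n = 0 -> enorm w <= r / 2%:R -> `|t| <= r / 2%:R ->
    enorm (x + w + t *: n - x) <= r.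
  by move=> wn wr tr; rewrite subDDK; apply: enorm_orthogonal_le => //; exact: ltW.
have r20 : r / 20%:R < r / 2%:R by clear - r0; lra.
have nr2 : `|r / 2%:R| <= r / 2%:R by rewrite ger0_norm // divr_ge0 // ltW.
have b0 t : `|t| <= r / 2%:R -> enorm (x + t *: n - x) <= r.
  by move=> tr; have := @b 0 t; rewrite addr0 dotp0l enorm0; apply=> //; lra.
have h (w : 'rV[R]_3) t : dotp w n = 0 -> dotp (x + w + t *: n - x) n = t.
  by move=> wn; rewrite subDDK dotpDl dotpZl wn nn; ring.
have h0 t : dotp (x + t *: n - x) n = t by rewrite subDK dotpZl nn mulr1.
have Ua : U (x + v + (r / 2%:R) *: n).
  apply: avoids_boundary_in Un => //; 
  by apply: (slab_avoids sl); [exact: b0|exact: b|rewrite h0|rewrite h].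
have nUb : ~ closure U (x + v + (- (r / 2%:R)) *: n).
  move: nUn; rewrite -scaleNr; apply: avoids_boundary_out => //.
  by apply: (slab_avoids (slabN sl)); [apply: b0|apply: b|rewrite dotpNr h0 opprK|
    rewrite dotpNr h ?opprK]; rewrite ?normrN.
have [t t01 St] := boundary_crossing oU Ua nUb.
pose s := (1 - t) * (r / 2%:R) + t * - (r / 2%:R).
have rE : ray (x + v + (r / 2%:R) *: n) (x + v + (- (r / 2%:R)) *: n) t =
    x + v + s *: n by apply: row3P; rewrite /ray /s !coordE; ring.
rewrite rE in St; exists s.
have sr : `|s| <= r / 2%:R.
  move: t01 => /andP[t0 t1]; rewrite /s.
  rewrite (_ : _ + _ = (1 - 2%:R * t) * (r / 2%:R)); last by ring.
  rewrite normrM (ger0_norm (_ : 0 <= r / 2%:R)); last by rewrite divr_ge0 // ltW.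
  by rewrite ler_piMl ?divr_ge0 ?(ltW r0) // ler_norml; lra.
have br := b _ _ vn vr sr; split => //; last by move: br; rewrite subDDK.
by have := sl _ St br; rewrite h.
Qed.

Lemma flat_two_sided_projection x r : 0 < r -> flat_two_sided x r ->
  big_projection (2%:R^-1) S x r.
Proof.
move=> r0 [n n1 [sl Un nUn]]; exists n => // v vn vr.
have [|t [_ St rt]] := flat_two_sided_crossing r0 n1 sl Un nUn vn; first by rewrite mulrC.
by exists t.
Qed.

(** A surface that crosses the lines parallel to [e] over a disc, and that lies in
    a slab, forces the normal of the slab to be transversal to the disc. *)
Lemma slab_tilt n e x r h s T : enorm n = 1 -> enorm e = 1 -> 0 <= s ->
  slab n x r h ->
  (forall v, dotp v e = 0 -> enorm v <= s -> exists t,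
     [/\ `|t| <= T, S (x + v + t *: e) & enorm (v + t *: e) <= r]) ->
  s * (1 - dotp n e ^+ 2) <= h + T * `|dotp n e|.
Proof.
move=> n1 e1 s0 sl cr.
have [w nE [we wn]] := unit_decomposition n1 e1.
have ws : dotp w w = 1 - dotp n e ^+ 2.
  by rewrite -sqr_enorm we sqr_sine.
have w1 : enorm w <= 1.
  apply: enorm_le; rewrite ?ler01 // ws expr1n; have := sqr_ge0 (dotp n e); lra.
have [||t [tT St tr]] := cr (s *: w).
- by rewrite dotpZl wn mulr0.
- by rewrite enormZ ger0_norm // ler_piMr.
have := sl _ St; rewrite subDDK => /(_ tr).
have -> : dotp (s *: w + t *: e) n = s * dotp w w + t * dotp n e.
  have wwn : dotp w n = dotp w w by rewrite {1}nE dotpDr dotpZr wn mulr0 add0r.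
  by rewrite dotpDl !dotpZl wwn (dotpC e).
rewrite ws => hh.
have := ler_norm (- (t * dotp n e)); rewrite normrN normrM.
have := ler_wpM2r (normr_ge0 (dotp n e)) tT.
have := ler_norm (s * (1 - dotp n e ^+ 2) + t * dotp n e).
lra.
Qed.

(** The caps of the ball outside a slab are convex and disjoint from the surface, so
    one point of [U] in the upper cap and one exterior point in the lower cap
    determine the sides of both. *)
Lemma two_sided_of_slab n e x r h k : enorm n = 1 -> enorm e = 1 -> 0 < r ->
  slab n x r h -> 0 < k -> k <= r -> h <= r / 20%:R -> h < k * `|dotp n e| ->
  U (x + k *: e) -> ~ closure U (x - k *: e) -> flat_two_sided x r.
Proof.
wlog ne0 : n / 0 <= dotp n e.
  move=> H n1 e1 r0 sl k0 kr hr hk Ue nUe.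
  have [ne|ne] := leP 0 (dotp n e); first exact: (H n).
  apply: (H (- n)); rewrite ?dotpNl ?normrN ?enormN //; first lra.
  exact: slabN.
move=> n1 e1 r0 sl k0 kr hr; rewrite ger0_norm // => hk Ue nUe.
have nn : dotp n n = 1 by rewrite -sqr_enorm n1 expr1n.
have be t : `|t| <= r -> enorm (x + t *: e - x) <= r.
  by rewrite subDK enormZ e1 mulr1.
have bn t : `|t| <= r -> enorm (x + t *: n - x) <= r.
  by rewrite subDK enormZ n1 mulr1.
have he t : dotp (x + t *: e - x) n = t * dotp n e.
  by rewrite subDK dotpZl (dotpC e).
have hn t : dotp (x + t *: n - x) n = t by rewrite subDK dotpZl nn mulr1.
have kn : `|k| <= r by rewrite gtr0_norm.
have rn : `|r / 2%:R| <= r by rewrite gtr0_norm; lra.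
have hr2 : h < r / 2%:R by clear - r0 hr; lra.
have avoid m : slab m x r h -> forall a b, `|a| <= r -> `|b| <= r ->
    h < dotp (x + a *: e - x) m -> h < dotp (x + b *: n - x) m ->
    avoids S (x + a *: e) (x + b *: n).
  move=> slm a b ar br ha hb.
  by apply: (slab_avoids slm); [exact: be|exact: bn|exact: ha|exact: hb].
exists n; first exact: n1.
split.
- by move=> y Sy yr; apply: le_trans hr; exact: sl.
- apply: avoids_boundary_in Ue; first exact: oU.
  by apply: (avoid n sl); rewrite ?he ?hn.
- move: nUe; rewrite -(scaleNr k) -(scaleNr (r / 2%:R)).
  apply: avoids_boundary_out; first exact: oU.
  by apply: (avoid _ (slabN sl)); rewrite ?normrN ?dotpNr ?he ?hn ?mulNr ?opprK.
Qed.

(** Two-sided flatness passes from scale [r] to scale [2 * r], given flatness at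
    the larger scale: the normals are close, so the caps of the larger ball meet
    the caps of the smaller one. *)
Lemma flat_two_sided_double n x r : 0 < r -> enorm n = 1 ->
  flat_two_sided x r -> slab n x (2%:R * r) (r / 20%:R) ->
  flat_two_sided x (2%:R * r).
Proof.
move=> r0 n1 [e e1 [sl Ue nUe]] sln.
have r2 : 0 <= r / 2%:R by rewrite divr_ge0 // ltW.
have cr v : dotp v e = 0 -> enorm v <= r / 2%:R -> exists t,
    [/\ `|t| <= r / 20%:R, S (x + v + t *: e) & enorm (v + t *: e) <= 2%:R * r].
  move=> ve vr; have [t [tr St br]] := flat_two_sided_crossing r0 e1 sl Ue nUe ve vr.
  by exists t; split => //; lra.
(* With [b] the cosine of the angle between the normals, this gives
   [1 - b ^ 2 <= 1 / 10 + b / 10]. *)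
have := slab_tilt n1 e1 r2 sln cr.
have a1 := dotp_unit_le n1 e1; set a := dotp n e in a1 *.
have -> : a ^+ 2 = `|a| ^+ 2 by rewrite real_normK ?num_real.
move: (normr_ge0 a) a1; set b := `|a| => b0 b1.
rewrite (_ : r / 2%:R * _ = r * ((1 - b ^+ 2) / 2%:R)); last by ring.
rewrite (_ : r / 20%:R + _ = r * (1 / 20%:R + b / 20%:R)); last by ring.
rewrite ler_pM2l // => hb.
have b2 : b ^+ 2 <= b by rewrite expr2 ler_piMr.
apply: (@two_sided_of_slab n e x _ _ (r / 2%:R) n1 e1 _ sln) => //; try lra.
rewrite -/a -/b (_ : r / 20%:R = r / 2%:R * (1 / 10%:R)); last by field.
by rewrite ltr_pM2l ?divr_gt0 //; lra.
Qed.

End two_sided_flatness.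

(** * Lipschitz boundaries separate locally *)

Section lipschitz_graphs.
Context {R : realType}.
Implicit Types (x y z u v w n e : 'rV[R]_3) (h r s t L d : R) (S U : set 'rV[R]_3).

(** [F] measures the signed height over the graph in direction [e], which turns the
    graph into a zero set and makes the coordinate system disappear. *)
Definition height_function S x e (F : 'rV[R]_3 -> R) L d :=
  [/\ enorm e = 1, forall y t, F (y + t *: e) = F y + t,
      forall y z, `|F y - F z| <= L * enorm (y - z) &
      forall y, enorm (y - x) < d -> (S y <-> F y = 0)].

Lemma dotp_mulmx u v (Q : 'M[R]_3) : Q *m Q^T = 1%:M ->
  dotp (u *m Q) (v *m Q) = dotp u v.
Proof.
move=> QQ; have dE a b : dotp a b = (a *m b^T) 0 0.
  by rewrite mxE; apply: eq_bigr => i _; rewrite mxE.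
by rewrite !dE trmx_mul mulmxA -(mulmxA u) QQ mulmx1.
Qed.

Lemma enorm_mulmx u (Q : 'M[R]_3) : Q *m Q^T = 1%:M -> enorm (u *m Q) = enorm u.
Proof. by move=> QQ; rewrite /enorm dotp_mulmx. Qed.

Lemma height_function_of_graph S x : locally_lipschitz_graph S x ->
  exists e F L d, [/\ 0 < L, 0 < d & height_function S x e F L d].
Proof.
move=> [Q [b [g [QQ [M [_ /(_ (`|M| + 1))]]]]]].
have -> : M < `|M| + 1 by have := ler_norm M; lra.
move=> /(_ isT); set K := `|M| + 1 => gK /nbhs_enormP[d d0 Sd].
have K0 : 0 < K by rewrite /K ltr_wpDl.
pose c y := y *m Q + b.
have QT : Q^T *m Q = 1%:M by apply: mulmx1C.
pose e : 'rV[R]_3 := delta_mx 0 2%:R *m Q^T.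
pose F y := c y 0 2%:R - g (c y 0 0, c y 0 1).
have ce y t : c (y + t *: e) = c y + t *: delta_mx 0 2%:R.
  by rewrite /c mulmxDl -scalemxAl /e -mulmxA QT mulmx1 addrAC.
exists e, F, (1 + K), d; split => //; first by rewrite addr_gt0.
split.
- rewrite /e enorm_mulmx ?trmxK //; apply/eqP.
  by rewrite -(eqrXn2 (n := 2)) ?enorm_ge0 // sqr_enorm dotpE !mxE /=;
    apply/eqP; ring.
- move=> y t; rewrite /F ce !mxE /=.
  by rewrite !mulr0 !addr0 mulr1; ring.
- move=> y z.
  have cyz i : `|c y 0 i - c z 0 i| <= enorm (y - z).
    have -> : c y 0 i - c z 0 i = ((y - z) *m Q) 0 i.
      by rewrite mulmxBl /c !mxE; ring.
    by rewrite -(enorm_mulmx (y - z) QQ) enorm_coord.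
  have gyz : `|g (c y 0 0, c y 0 1) - g (c z 0 0, c z 0 1)| <= K * enorm (y - z).
    have := gK ((c y 0 0, c y 0 1), (c z 0 0, c z 0 1)) (conj I I) => /= h.
    apply: le_trans h _; apply: ler_wpM2l; first exact: ltW.
    by rewrite prod_normE /= ge_max !cyz.
  rewrite mulrDl mul1r; have := cyz 2%:R; rewrite /F.
  move: gyz; rewrite !ler_norml; lra.
- move=> y /Sd; rewrite -/(c y) /F => ->.
  by split => [->|/eqP]; [rewrite subrr|rewrite subr_eq0 => /eqP].
Qed.

Lemma height_functionN S x e F L d : height_function S x e F L d ->
  height_function S x (- e) (fun y => - F y) L d.
Proof.
move=> [e1 Fe FL FS]; split.
- by rewrite enormN.
- by move=> y t; rewrite scalerN -scaleNr Fe; ring.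
- by move=> y z; rewrite -opprD normrN.
- move=> y /FS ->; split=> [->|/eqP]; first by rewrite oppr0.
  by rewrite oppr_eq0 => /eqP.
Qed.

(** Two points above the graph are joined by a path that goes up, moves
    horizontally, and comes down without meeting the graph. *)
Lemma height_positive_avoids S x e F L d y z : 0 < L ->
  height_function S x e F L d ->
  enorm (y - x) < d / (2%:R * (1 + 2%:R * L)) ->
  enorm (z - x) < d / (2%:R * (1 + 2%:R * L)) ->
  0 < F y -> 0 < F z ->
  exists t, [/\ avoids S y (y + t *: e), avoids S (y + t *: e) (z + t *: e) &
                avoids S (z + t *: e) z].
Proof.
move=> L0 [e1 Fe FL FS]; set q := d / _ => yq zq y0 z0.
have q0 : 0 < q by apply: le_lt_trans yq; exact: enorm_ge0.
have dq : q + 2%:R * L * q = d / 2%:R by rewrite /q; field; lra.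
have Lq : 0 <= L * q by rewrite mulr_ge0 // ltW.
pose T := 2%:R * L * q.
have T0 : 0 <= T by rewrite /T -mulrA mulr_ge0.
have up w : enorm (w - x) < q -> enorm (w + T *: e - x) <= d / 2%:R.
  move=> wq; rewrite addrAC; apply: le_trans (enormD _ _) _.
  by rewrite enormZ e1 mulr1 ger0_norm // -dq lerD // ltW.
have dd : d / 2%:R < d by rewrite /T in T0; lra.
have qd w : enorm (w - x) < q -> enorm (w - x) <= d / 2%:R.
  by move=> wq; rewrite /T in T0; lra.
have pos w w' : enorm (w - x) <= d / 2%:R -> enorm (w' - x) <= d / 2%:R ->
    (forall t, 0 <= t <= 1 -> 0 < F (ray w w' t)) -> avoids S w w'.
  move=> wd wd' h t t01; have := h t t01; have := ray_ball_le t01 wd wd'.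
  by move=> /le_lt_trans/(_ dd)/FS -> + F0; rewrite F0 ltxx.
have vert w : enorm (w - x) < q -> 0 < F w -> avoids S w (w + T *: e).
  move=> wq w0; apply: pos; rewrite ?up ?qd // => t /andP[t0 t1].
  have -> : ray w (w + T *: e) t = w + (t * T) *: e.
    by apply: row3P; rewrite /ray !coordE; ring.
  by rewrite Fe ltr_wpDr // mulr_ge0.
exists T; split; [exact: vert| |by apply: avoidsC; exact: vert].
apply: pos; rewrite ?up // => t /andP[t0 t1].
have -> : ray (y + T *: e) (z + T *: e) t = ray y z t + T *: e.
  by apply: row3P; rewrite /ray !coordE; ring.
rewrite Fe.
have yz : enorm (ray y z t - y) <= 2%:R * q.
  have -> : ray y z t - y = t *: ((z - x) - (y - x)).
    by apply: row3P; rewrite /ray !coordE; ring.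
  rewrite enormZ ger0_norm //.
  apply: le_trans (_ : enorm (z - x - (y - x)) <= _); first by rewrite ler_piMl // enorm_ge0.
  by apply: le_trans (enormBD _ _) _; lra.
have := FL (ray y z t) y; have := ler_wpM2l (ltW L0) yz; rewrite ler_norml /T.
lra.
Qed.

Lemma height_side_in U x e F L d y z : open U -> 0 < L ->
  height_function (boundary U) x e F L d ->
  enorm (y - x) < d / (2%:R * (1 + 2%:R * L)) ->
  enorm (z - x) < d / (2%:R * (1 + 2%:R * L)) ->
  0 < F y -> 0 < F z -> U y -> U z.
Proof.
move=> oU L0 hF yq zq y0 z0 Uy.
have [t [a1 a2 a3]] := height_positive_avoids L0 hF yq zq y0 z0.
apply: avoids_boundary_in a3 _ => //; apply: avoids_boundary_in a2 _ => //.
exact: avoids_boundary_in a1 _.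
Qed.

Lemma open_boundary_cases U y : open U -> ~ boundary U y -> U y \/ ~ closure U y.
Proof.
move=> oU; rewrite /boundary (interior_id U).1 // => nb.
have [cy|] := pselect (closure U y); last by right.
by left; apply: contrapT => nU; apply: nb.
Qed.

(** If [U] lay on both sides of its boundary at one point, it would do so at all
    points because the boundary is connected; the closure of [U] would then be
    open, and a bounded nonempty set cannot be open and closed. *)
Lemma boundary_not_interior_closure U : bounded_domain U ->
  connected (boundary U) ->
  (forall x, boundary U x -> locally_lipschitz_graph (boundary U) x) ->
  forall x, boundary U x -> ~ interior (closure U) x.
Proof.
move=> [oU _ [a Ua] bU] cS lipS x Sx xi.
pose A := boundary U `&` interior (closure U).
have oI : open (interior (closure U)) by exact: open_interior.
have AE : A = boundary U.
  apply: cS; [by exists x|by exists (interior (closure U))|].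
  exists (closure A); first exact: closed_closure.
  apply/seteqP; split=> [y Ay|y [Sy cAy]].
    by split; [exact: Ay.1|exact: subset_closure].
  split => //.
  have [e [F [L [d [L0 d0 hF]]]]] := height_function_of_graph (lipS y Sy).
  set q := d / (2%:R * (1 + 2%:R * L)).
  have q0 : 0 < q by rewrite /q divr_gt0 // mulr_gt0 //; lra.
  have qd : q <= d.
    by rewrite /q ler_pdivrMr; [rewrite ler_peMr ?ltW //; lra|rewrite mulr_gt0 //; lra].
  have [y' [Sy' iy'] yq'] := (closureP_enorm A y).1 cAy q q0.
  have /openP_enorm/(_ y' iy')[h h0 hI] := oI.
  have side e' F' : height_function (boundary U) y e' F' L d ->
      forall z, enorm (z - y) < q -> 0 < F' z -> U z.
    move=> hF' z zq z0; have [e1' Fe' FL' FS'] := hF'.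
    pose t := Num.min (h / 2%:R) ((q - enorm (y' - y)) / 2%:R).
    have t0 : 0 < t by rewrite /t lt_min !divr_gt0 ?subr_gt0.
    have th : t <= h / 2%:R by rewrite /t ge_min lexx.
    have tq : t <= (q - enorm (y' - y)) / 2%:R by rewrite /t ge_min lexx orbT.
    have te : enorm (t *: e') = t by rewrite enormZ e1' mulr1 gtr0_norm.
    have wq : enorm (y' + t *: e' - y) < q.
      rewrite addrAC; apply: le_lt_trans (enormD _ _) _; rewrite te; lra.
    have Fw : 0 < F' (y' + t *: e').
      by rewrite Fe' ((FS' y' _).1 Sy') ?add0r //; lra.
    apply: (height_side_in oU L0 hF' wq zq Fw z0).
    have nb : ~ boundary U (y' + t *: e').
      by rewrite FS'; [move=> F0; move: Fw; rewrite F0 ltxx|lra].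
    have [//|] := open_boundary_cases oU nb.
    by case; apply: interior_subset; apply: hI; rewrite subDK te; lra.
  apply/nbhs_enormP; exists q => // z zq.
  have [F0|F0|F0] := ltgtP 0 (F z).
  - by apply: subset_closure; exact: side hF z zq F0.
  - apply: subset_closure; apply: (side _ _ (height_functionN hF) z zq).
    by rewrite oppr_gt0.
  - have [_ _ _ FS] := hF; have : boundary U z by rewrite FS //; lra.
    by case.
(* All boundary points are now interior to the closure, which is thus open. *)
have oC : open (closure U).
  have -> : closure U = interior (closure U); last exact: oI.
  apply/seteqP; split; last exact: interior_subset.
  move=> y cy; have [Uy|nUy] := pselect (U y).
    by move: oU; rewrite openE => /(_ y Uy); apply: filterS; exact: subset_closure.
  have : A y by rewrite AE /boundary (interior_id U).1.
  by case.
have [M [_ /(_ (`|M| + 1))]] := bU.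
have -> : M < `|M| + 1 by have := ler_norm M; lra.
move=> /(_ isT) MU.
have bC y : closure U y -> enorm y <= 3%:R * (`|M| + 1) + 1.
  move=> /closureP_enorm/(_ 1 ltr01)[z Uz zy].
  have := enorm_tri z y 0; rewrite !subr0 (enormB y).
  by have := enorm_le_normrV z; have := MU z Uz; rewrite /=; lra.
(* A closed and open set contains every segment that starts in it, so it reaches
   points beyond any bound. *)
pose far : 'rV[R]_3 := (3%:R * (`|M| + 1) + 2%:R) *: delta_mx 0 0.
have : closure U far.
  apply: (@avoids_boundary_in R (closure U) a far oC); last exact: subset_closure.
  move=> t _; rewrite /boundary (interior_id _).1 // -(closure_id _).1 //; last exact: closed_closure.
  by case.
move=> /bC; have := enorm_coord far 0; rewrite /far !mxE /= mulr1.
have := ler_norm (3%:R * (`|M| + 1) + 2%:R); have := normr_ge0 M; lra.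
Qed.

(** Near a boundary point there are points of [U] and points outside its closure;
    each side of the graph lies in one of these sets, and up to reversing the
    direction of the graph, [U] lies above it. *)
Lemma two_sided_height_function U x : bounded_domain U ->
  connected (boundary U) ->
  (forall x, boundary U x -> locally_lipschitz_graph (boundary U) x) ->
  boundary U x -> exists e F L d,
    [/\ 0 < L, 0 < d, height_function (boundary U) x e F L d &
        forall y, enorm (y - x) < d ->
          (0 < F y -> U y) /\ (F y < 0 -> ~ closure U y)].
Proof.
move=> dU cS lipS Sx; have [oU _ _ _] := dU.
have nI := boundary_not_interior_closure dU cS lipS Sx.
have [e0 [F0 [L [d [L0 d0 hF0]]]]] := height_function_of_graph (lipS x Sx).
set q := d / (2%:R * (1 + 2%:R * L)).
have q0 : 0 < q by rewrite /q divr_gt0 // mulr_gt0 //; lra.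
have qd : q <= d.
  by rewrite /q ler_pdivrMr; [rewrite ler_peMr ?ltW //; lra|rewrite mulr_gt0 //; lra].
have [a Ua aq] : exists2 a, U a & enorm (a - x) < q.
  by apply: (closureP_enorm U x).1 => //; case: Sx.
have [b nUb bq] : exists2 b, ~ closure U b & enorm (b - x) < q.
  apply: contrapT => h; apply: nI; apply/nbhs_enormP; exists q => // y yq.
  by apply: contrapT => ny; apply: h; exists y.
have [e [F [hF Fa]]] : exists e F,
    height_function (boundary U) x e F L d /\ 0 < F a.
  have [F0a|F0a|F0a] := ltgtP 0 (F0 a); first by exists e0, F0.
    exists (- e0), (fun y => - F0 y); split; first exact: height_functionN.
    by rewrite oppr_gt0.
  have [_ _ _ /(_ a)] := hF0; rewrite -F0a => FS.
  have : boundary U a by apply FS; lra.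
  by rewrite /boundary (interior_id U).1 // => -[].
have posU y : enorm (y - x) < q -> 0 < F y -> U y.
  by move=> yq Fy; exact: (height_side_in oU L0 hF aq yq Fa Fy Ua).
have [e1 Fe FL FS] := hF.
have Fb : F b < 0.
  have [//|Fb|Fb] := ltgtP (F b) 0.
    by case: nUb; apply: subset_closure; exact: posU.
  have : boundary U b by rewrite FS //; lra.
  by move=> [cb]; case: nUb.
exists e, F, L, q; split => //.
  by split => // y yq; apply: FS; lra.
move=> y yq; split; first exact: posU.
move=> Fy; have hN := height_functionN hF.
have [||t [a1 a2 a3]] := height_positive_avoids L0 hN bq yq; rewrite ?oppr_gt0 //.
apply: avoids_boundary_out a3 _ => //; apply: avoids_boundary_out a2 _ => //.
exact: avoids_boundary_out a1 _.
Qed.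

End lipschitz_graphs.

(** * Two-sided flatness up to a scale controlled by the energy *)

Section uniform_scale.
Context {R : realType}.
Implicit Types (x y z u v w n e : 'rV[R]_3) (h r s t L d p c E : R) (S U : set 'rV[R]_3).

(** This multiple of [E ^ (- 1 / (p - 8))] is the scale at which the bound [flatness]
    equals [eps]. *)
Definition scale_const p c eps :=
  (energy_const p c * (eps * c ^+ 2) `^ (p + 8%:R)) `^ (p - 8%:R)^-1.

Lemma scale_const_gt0 p c eps : 0 < c -> 0 < eps -> 0 < scale_const p c eps.
Proof.
move=> c0 e0; rewrite /scale_const powR_gt0 // mulr_gt0 ?energy_const_gt0 //.
by rewrite powR_gt0 // mulr_gt0 // exprn_gt0.
Qed.

Lemma flatness_base_le p c E eps r : 8%:R < p -> 0 < c -> 0 < eps -> 0 < E ->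
  0 < r -> r <= scale_const p c eps * E `^ (- (p - 8%:R)^-1) ->
  E * r `^ (p - 8%:R) / energy_const p c <= (eps * c ^+ 2) `^ (p + 8%:R).
Proof.
move=> p8 c0 e0 E0 r0 hr; have k0 := energy_const_gt0 p c0.
have p80 : 0 < p - 8%:R by rewrite subr_gt0.
rewrite ler_pdivrMr // mulrC -ler_pdivlMr //.
have : r `^ (p - 8%:R) <=
    (scale_const p c eps * E `^ (- (p - 8%:R)^-1)) `^ (p - 8%:R).
  rewrite ge0_ler_powR ?nnegrE ?(ltW p80) ?(ltW r0) //.
  by apply: le_trans hr; exact: ltW.
move=> /le_trans; apply.
rewrite powRM ?powR_ge0 // /scale_const -!powRrM mulNr !mulVf ?gt_eqF //.
rewrite powRr1; last by rewrite mulr_ge0 ?powR_ge0 // ltW.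
by rewrite powR_inv1 ?(ltW E0) // (mulrC (energy_const _ _)).
Qed.

Lemma flatness_le p c E eps r : 8%:R < p -> 0 < c -> 0 < eps -> 0 < E ->
  0 < r -> r <= scale_const p c eps * E `^ (- (p - 8%:R)^-1) ->
  flatness p c E r <= eps.
Proof.
move=> p8 c0 e0 E0 r0 hr.
have c2 : 0 < c ^+ 2 by rewrite exprn_gt0.
have p80 : 0 < p + 8%:R by lra.
have := flatness_base_le p8 c0 e0 E0 r0 hr; set t := E * _ / _ => ht.
have t0 : 0 <= t.
  rewrite /t divr_ge0 ?(ltW (energy_const_gt0 _ c0)) //.
  by rewrite mulr_ge0 ?powR_ge0 // ltW.
rewrite /flatness ler_pdivrMr //.
have : t `^ (p + 8%:R)^-1 <= ((eps * c ^+ 2) `^ (p + 8%:R)) `^ (p + 8%:R)^-1.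
  by rewrite ge0_ler_powR ?nnegrE ?powR_ge0 ?invr_ge0 ?(ltW p80).
rewrite -powRrM divff ?gt_eqF // powRr1 //.
by rewrite mulr_ge0 ?(ltW e0) ?(ltW c2).
Qed.

Section surface.
Variables (U : set 'rV[R]_3) (p E : R).
Hypothesis dU : bounded_domain U.
Hypothesis cS : connected (boundary U).
Hypothesis kS : compact (boundary U).
Hypothesis lipS :
  forall x, boundary U x -> locally_lipschitz_graph (boundary U) x.
Hypothesis p8 : 8%:R < p.
Hypothesis E0 : 0 < E.
Hypothesis energyS : (integral_menger p (boundary U) <= E%:E)%E.

Let oU : open U. Proof. by case: dU. Qed.

Let clS : closed (boundary U).
Proof.
rewrite /boundary setDE; apply: closedI; first exact: closed_closure.
by apply: open_closedC; exact: open_interior.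
Qed.

(** The Lipschitz constant provides big projections near [x], with a constant that
    depends on the surface; at sufficiently small scales finite energy turns them
    into two-sided flatness with the absolute tolerance. *)
Lemma local_flat_two_sided x : boundary U x -> exists2 d, 0 < d &
  forall y r, boundary U y -> enorm (y - x) < d -> 0 < r -> r < d ->
    flat_two_sided U y r.
Proof.
move=> Sx.
have [e [F [L [d [L0 d0 [e1 Fe FL FS] side]]]]] :=
  two_sided_height_function dU cS lipS Sx.
pose c := (1 + L)^-1.
have c0 : 0 < c by rewrite invr_gt0; lra.
have cL : L * c = 1 - c by rewrite /c; field; lra.
have lift y v : boundary U y -> dotp v e = 0 -> enorm (y - x) + (1 + L) * enorm v < d ->
    exists t, [/\ `|t| <= L * enorm v, boundary U (y + v + t *: e) &
                  enorm (v + t *: e) <= (1 + L) * enorm v].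
  move=> Sy ve hv; have v0 := enorm_ge0 v.
  have Lv : 0 <= L * enorm v by rewrite mulr_ge0 // ltW.
  have Fy : F y = 0 by apply/FS => //; lra.
  have tL : `|- F (y + v)| <= L * enorm v.
    by rewrite normrN; have := FL (y + v) y; rewrite Fy subr0 subDK.
  have tv : enorm (v + - F (y + v) *: e) <= (1 + L) * enorm v.
    apply: le_trans (enormD _ _) _; rewrite enormZ e1; lra.
  exists (- F (y + v)); split => //; apply/FS; last by rewrite Fe subrr.
  have -> : y + v + - F (y + v) *: e - x = (y - x) + (v + - F (y + v) *: e).
    by apply: row3P; rewrite !coordE; ring.
  by apply: le_lt_trans (enormD _ _) _; lra.
have cv v s : enorm v <= c * s -> (1 + L) * enorm v <= s.
  by rewrite /c mulrC ler_pdivlMr 1?mulrC //; lra.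
have bp y s : boundary U y -> enorm (y - x) < d / 2%:R -> 0 < s -> s < d / 2%:R ->
    big_projection c (boundary U) y s.
  move=> Sy yd s0 sd; exists e => // v ve /cv vs.
  have [|t [_ St tv]] := @lift y v Sy ve; first lra.
  by exists t => //; exact: le_trans vs.
(* A slab of relative thickness at most [c / 8] is too thin for its normal to be
   almost orthogonal to [e]; [1 / 20] is the tolerance of two-sided flatness. *)
pose eps := Num.min (c / 8%:R) (1 / 20%:R).
have eps0 : 0 < eps by rewrite /eps lt_min !divr_gt0.
have epsc : eps <= c / 8%:R by rewrite /eps ge_min lexx.
have eps20 : eps <= 1 / 20%:R by rewrite /eps ge_min lexx orbT.
pose R1 := scale_const p c eps * E `^ (- (p - 8%:R)^-1).
have R10 : 0 < R1 by rewrite mulr_gt0 ?scale_const_gt0 ?powR_gt0.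
exists (Num.min (d / 8%:R) R1); first by rewrite lt_min R10 divr_gt0.
move=> y r' Sy; rewrite !lt_min => /andP[yd _] r'0 /andP[r'd r'R].
pose r := r' / 2%:R; have r0 : 0 < r by rewrite divr_gt0.
have r'E : r' = 2%:R * r by rewrite /r mulrC divfK // pnatr_eq0.
have rd : r < d / 16%:R by rewrite /r; lra.
have [|n n1 sl] := flat_of_energy p8 c0 r0 clS energyS Sy.
  move=> z s Sz zy s0 sr; apply: bp => //; last by lra.
  by have := enorm_tri y z x; lra.
have om : flatness p c E r <= eps.
  by apply: flatness_le => //; rewrite -/R1; lra.
have om0 : 0 <= flatness p c E r by rewrite divr_ge0 ?powR_ge0 ?sqr_ge0.
set h := flatness p c E r in sl om om0.
have {}sl : slab U n y (2%:R * r) (h * r) by [].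
have hr : h * r <= eps * r by rewrite ler_wpM2r // ltW.
have epr : eps * r <= c / 8%:R * r by rewrite ler_wpM2r // ltW.
have cr0 : 0 < c * r by rewrite mulr_gt0.
have c1 : c <= 1 by have : 0 <= L * c by [rewrite mulr_ge0 // ltW]; lra.
have tilt : c / 4%:R <= `|dotp n e|.
  have := @slab_tilt R U n e y (2%:R * r) (h * r) (c * r) (L * (c * r)) n1 e1 (ltW cr0) sl.
  have crs v : dotp v e = 0 -> enorm v <= c * r -> exists t,
      [/\ `|t| <= L * (c * r), boundary U (y + v + t *: e) &
          enorm (v + t *: e) <= 2%:R * r].
    move=> ve vr; have vr' := cv _ _ vr.
    have [|t [tL St tv]] := @lift y v Sy ve; first by lra.
    exists t; split => //; last by lra.
    by apply: le_trans tL _; rewrite ler_wpM2l // ltW.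
  move=> /(_ crs).
  have := dotp_unit_le n1 e1; set a := dotp n e => a1.
  have -> : a ^+ 2 = `|a| ^+ 2 by rewrite real_normK ?num_real.
  move: (normr_ge0 a) a1; set b := `|a| => b0 b1 hb.
  rewrite leNgt; apply/negP => bc.
  have {}hb : c * (1 - b ^+ 2) <= c / 8%:R + (1 - c) * b.
    rewrite -(ler_pM2r r0); move: hb; rewrite (mulrA L) cL; lra.
  have b4 : b <= 4%:R^-1 by lra.
  have bb : b ^+ 2 <= 4%:R^-1 by rewrite expr2; apply: le_trans b4; exact: ler_piMr.
  have h1 := ler_wpM2l (ltW c0) bb.
  have h2 : 0 <= c * b by rewrite mulr_ge0 // ltW.
  by lra.
rewrite r'E; apply: (@two_sided_of_slab R U oU n e y _ _ r n1 e1 _ sl) => //.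
- by rewrite mulr_gt0.
- by lra.
- by have := ler_wpM2r (ltW r0) eps20; lra.
- have := ler_wpM2l (ltW r0) tilt; lra.
- apply: (side _ _).1; last by rewrite Fe ((FS y _).1 Sy) ?add0r //; lra.
  rewrite addrAC; apply: le_lt_trans (enormD _ _) _.
  by rewrite enormZ e1 gtr0_norm //; lra.
- rewrite -scaleNr; apply: (side _ _).2.
    rewrite addrAC; apply: le_lt_trans (enormD _ _) _.
    by rewrite enormZ e1 normrN gtr0_norm //; lra.
  by rewrite Fe ((FS y _).1 Sy) ?add0r ?oppr_lt0 //; lra.
Qed.

(** The surface is compact, so finitely many of the neighbourhoods in
    [local_flat_two_sided] cover it. *)
Lemma small_scales_flat_two_sided : exists2 r0, 0 < r0 &
  forall x r, boundary U x -> 0 < r -> r <= r0 -> flat_two_sided U x r.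
Proof.
pose P i y := boundary U y -> forall r, 0 < r -> r <= i -> flat_two_sided U y r.
have : \forall i \near 0^'+, boundary U `<=` P i.
  have cov := (compact_near_coveringP _).1 kS; apply: cov => x Sx.
  have [d d0 hd] := local_flat_two_sided Sx.
  exists ([set y | enorm (y - x) < d], [set i : R | i < d]) => /=.
    split; first by apply/nbhs_enormP; exists d.
    by apply: nbhs_right_lt.
  move=> [y i] [/= yd id] Sy r r0 ri; apply: hd => //; exact: le_lt_trans id.
move=> h.
have [r0 r00 hr] : exists2 r0 : R, 0 < r0 & boundary U `<=` P r0.
  near (0:R)^'+ => i; exists i => //.
  by near: i; exact: h.
exists r0 => // x r Sx; exact: (hr x Sx Sx r).
Unshelve. all: by end_near.
Qed.

(** Here [2^-1] is the constant of the big projections of two-sided flat sets, and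
    [1 / 20] is the tolerance of two-sided flatness. *)
Definition regular_radius := scale_const p 2%:R^-1 (1 / 20%:R) * E `^ (- (p - 8%:R)^-1).

Lemma regular_radius_gt0 : 0 < regular_radius.
Proof. by rewrite mulr_gt0 ?scale_const_gt0 ?powR_gt0 // divr_gt0. Qed.

Lemma slab_of_flat_two_sided x r : boundary U x -> 0 < r ->
  (forall y s, boundary U y -> 0 < s -> s <= r -> flat_two_sided U y s) ->
  exists2 n, enorm n = 1 & slab U n x (2%:R * r) (flatness p 2%:R^-1 E r * r).
Proof.
move=> Sx r0 good.
have c0 : 0 < 2%:R^-1 :> R by rewrite invr_gt0.
have [|n n1 sl] := flat_of_energy p8 c0 r0 clS energyS Sx; last by exists n.
move=> y s Sy _ s0 sr; apply: flat_two_sided_projection => //.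
exact: good.
Qed.

(** Doubling the scale costs nothing as long as the energy makes the surface flat
    at the larger scale, and this depends only on [p] and [E]. *)
Lemma all_scales_flat_two_sided x r : boundary U x -> 0 < r ->
  r <= regular_radius -> flat_two_sided U x r.
Proof.
have [r0 r00 small] := small_scales_flat_two_sided.
suff step k : forall x r, boundary U x -> 0 < r -> r <= 2%:R ^+ k * r0 ->
    r <= regular_radius -> flat_two_sided U x r.
  move=> Sx rp rR; pose k := Num.truncn (r / r0).
  apply: (step k.+1) => //; rewrite -ler_pdivrMr //.
  have /andP[_ /ltW h] := truncn_itv (ltW (divr_gt0 rp r00)).
  apply: le_trans h _; rewrite -natrX ler_nat ltnW //; exact: ltn_expl.
(* Every step extends the range of scales at all points of the surface at once. *)
elim: k => [|k IH] {}x {}r Sx rp.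
  by rewrite expr0 mul1r => rr _; exact: small.
rewrite exprS -mulrA => rk rR.
pose s := r / 2%:R; have s0 : 0 < s by rewrite divr_gt0.
have rE : r = 2%:R * s by rewrite /s mulrC divfK // pnatr_eq0.
have sR : s <= regular_radius by apply: le_trans rR; rewrite rE; lra.
have good y t : boundary U y -> 0 < t -> t <= s -> flat_two_sided U y t.
  move=> Sy t0 ts; apply: IH => //; last exact: le_trans sR.
  by lra.
have [n n1 sl] := slab_of_flat_two_sided Sx s0 good.
rewrite rE; apply: (@flat_two_sided_double R U oU n x s s0 n1).
  exact: good.
move=> y Sy ys; apply: le_trans (sl y Sy ys) _.
rewrite mulrC ler_pM2l //.
have : flatness p 2%:R^-1 E s <= 1 / 20%:R.
  by apply: flatness_le => //; rewrite ?invr_gt0 ?divr_gt0.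
by rewrite div1r.
Qed.

End surface.
End uniform_scale.

(** * Angles and distances of planes *)

Section plane_angles.
Context {R : realType}.
Implicit Types (P Q : {vspace 'rV[R]_3}) (x y v n m : 'rV[R]_3).

(** By the mean value theorem [sin a >= a / 2] where [cos a >= 1 / 2]; where
    [cos a < 1 / 2], the sine is at least [1 / 2] while [a <= 4]. *)
Lemma acos_le_sine (t : R) : 0 <= t <= 1 -> acos t <= 8%:R * Num.sqrt (1 - t ^+ 2).
Proof.
move=> /andP[t0 t1]; have t11 : -1 <= t <= 1 by rewrite t1 andbT; lra.
have [th a_cos] := acos_def t11; have /andP[th0 thpi] := th.
rewrite -sin_acos //; set a := acos t in th th0 thpi a_cos *.
have s0 : 0 <= sin a by apply: sin_ge0_pi.
have [t2|t2] := leP (1 / 2%:R) t; last first.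
  have : (1 / 2%:R) <= sin a.
    rewrite -(ler_pXn2r (n := 2)) ?nnegrE //.
    rewrite sin2cos2 a_cos; have : t * t <= 1 / 2%:R * (1 / 2%:R).
      by apply: ler_pM => //; exact: ltW.
    by rewrite !expr2; lra.
  by have := pihalf_lt2 R; lra.
have [->|a0] := eqVneq a 0; first by rewrite sin0 mulr0.
have {a0}a0 : 0 < a by rewrite lt_def a0.
have sc : {within `[0, a], continuous sin}.
  by apply: continuous_subspaceT => c; exact: continuous_sin.
have [c] := MVT a0 (fun c _ => is_derive_sin c) sc.
rewrite in_itv /= sin0 !subr0 => /andP[c0 ca] ->.
have : cos a < cos c by rewrite ltr_cos // in_itv /=; lra.
rewrite a_cos => tc.
have := ler_wpM2r th0 (_ : 1 / 2%:R <= cos c); lra.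
Qed.

Lemma dist_plane_normal x y n P : enorm n = 1 ->
  (forall v, v \in P <-> dotp v n = 0) -> dist_plane y x P = `|dotp (y - x) n|.
Proof.
move=> n1 hP; apply/eqP; rewrite eq_le; apply/andP; split.
  apply: ge_inf; first by exists 0 => _ [v _ <-]; exact: enorm_ge0.
  have [w wE [ws wn]] : exists2 w, y - x = dotp (y - x) n *: n + w &
      True /\ dotp w n = 0.
    move: (y - x) => z; exists (z - dotp z n *: n); first by rewrite addrC subrK.
    by split => //; rewrite dotpBl dotpZl -sqr_enorm n1; ring.
  exists w; first exact/hP.
  rewrite (_ : y - (x + w) = dotp (y - x) n *: n) ?enormZ ?n1 ?mulr1 //.
  by rewrite opprD addrA {1}wE addrK.
apply: lb_le_inf; first by exists (enorm (y - (x + 0))), 0 => //=; exact: mem0v.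
move=> _ [v /hP vn <-].
have -> : dotp (y - x) n = dotp (y - (x + v)) n.
  by rewrite !(dotpBl, dotpDl) vn addr0.
by have := cauchy_schwarz (y - (x + v)) n; rewrite n1 mulr1.
Qed.

Lemma sine_unit_normal n P : enorm n = 1 ->
  (forall v, v \in P <-> dotp v n = 0) ->
  enorm (unit_normal P) = 1 /\ sine (unit_normal P) n = 0.
Proof.
move=> n1 hP.
have [u1 uP] : [set u | enorm u = 1 /\ forall v, v \in P -> dotp u v = 0]
    (unit_normal P).
  apply: xgetPex; exists n; split => // v /hP; by rewrite dotpC.
split => //; have [w wE [ws wn]] := unit_decomposition u1 n1.
rewrite -ws; suff -> : w = 0 by rewrite enorm0.
apply: dotp_eq0; have : dotp (unit_normal P) w = 0 by apply/uP/hP.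
by rewrite {1}wE dotpDl dotpZl (dotpC n) wn mulr0 add0r.
Qed.

Lemma plane_angle_le n m P Q : enorm n = 1 -> enorm m = 1 ->
  (forall v, v \in P <-> dotp v n = 0) -> (forall v, v \in Q <-> dotp v m = 0) ->
  0 <= plane_angle P Q <= 8%:R * sine n m.
Proof.
move=> n1 m1 hP hQ.
have [u1 us] := sine_unit_normal n1 hP; have [w1 ws] := sine_unit_normal m1 hQ.
set u := unit_normal P in u1 us; set w := unit_normal Q in w1 ws.
have uw : sine u w <= sine n m.
  have := sine_tri u1 n1 w1; have := sine_tri n1 m1 w1.
  by rewrite us (sineC m) ws; lra.
rewrite /plane_angle -/u -/w.
have t1 := dotp_unit_le u1 w1; have t0 := normr_ge0 (dotp u w).
rewrite acos_ge0 ?t1 ?andbT //=; last by lra.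
apply: le_trans (acos_le_sine _) _; first by rewrite t0 t1.
rewrite ler_pM2l // real_normK ?num_real // -sqr_sine // sqrtr_sqr.
by rewrite ger0_norm ?sine_ge0.
Qed.

End plane_angles.

(** * Tangent planes of sets that are flat at all small scales *)

Section tangent_planes.
Context {R : realType}.

(** The ratio of the values of [r ^ kappa] at consecutive dyadic scales. *)
Definition decay (kappa : R) := 2%:R^-1 `^ kappa.

(** The first factor sums the geometric series of the angles between consecutive
    slabs; the second is lost in passing from dyadic to arbitrary scales. *)
Definition tangent_const (kappa : R) :=
  (1 + 24%:R / (1 - decay kappa)) * (2%:R / decay kappa).

Definition angle_const (kappa : R) :=
  8%:R * tangent_const kappa * (2%:R + 2%:R / decay kappa).

Implicit Types (x y z u v w n m : 'rV[R]_3) (r s h e : R).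
Variables (S : set 'rV[R]_3) (R0 W kappa : R).
Hypothesis R00 : 0 < R0.
Hypothesis W0 : 0 <= W.
Hypothesis kappa0 : 0 < kappa.
Hypothesis bp : forall x r, S x -> 0 < r -> r <= R0 ->
  big_projection (2%:R^-1) S x r.
Hypothesis flat : forall x r, S x -> 0 < r -> r <= R0 ->
  exists2 n, enorm n = 1 & forall y, S y -> enorm (y - x) <= 2%:R * r ->
    `|dotp (y - x) n| <= W * r `^ kappa * r.

(** Two slabs containing the same piece of [S] are almost parallel because that
    piece spans a plane. *)
Lemma normals_close x r n m (h h' : R) : S x -> 0 < r -> r <= R0 ->
  enorm n = 1 -> enorm m = 1 ->
  (forall y, S y -> enorm (y - x) <= r -> `|dotp (y - x) n| <= h) ->
  (forall y, S y -> enorm (y - x) <= r -> `|dotp (y - x) m| <= h') ->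
  sine n m <= 8%:R * (h + h') / r.
Proof.
move=> Sx r0 rR n1 m1 hn hm.
have c0 : 0 < 2%:R^-1 :> R by rewrite invr_gt0.
have [u [v [[Su Sv] ur vr uvr]]] := big_projection_frame c0 r0 (bp Sx r0 rR).
have c4 : 0 < (2%:R^-1 : R) ^+ 2 by rewrite exprn_gt0.
have N0 : 0 < enorm (cross u v).
  by apply: lt_le_trans uvr; rewrite mulr_gt0 ?exprn_gt0.
have k1 := enorm_cross_gt0_unit N0.
have hu := hn _ Su; have hv := hn _ Sv; have hu' := hm _ Su; have hv' := hm _ Sv.
rewrite !subDK in hu hv hu' hv'.
have s1 := sine_cross_le n1 r0 c4 ur vr uvr (hu ur) (hv vr).
have s2 := sine_cross_le m1 r0 c4 ur vr uvr (hu' ur) (hv' vr).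
apply: le_trans (sine_tri n1 k1 m1) _; rewrite (sineC _ m).
apply: le_trans (lerD s1 s2) _; rewrite le_eqVlt; apply/orP; left; apply/eqP.
by field; rewrite gt_eqF.
Qed.

Let q := decay kappa.
Let rad k := R0 * 2%:R^-1 ^+ k.
Let a k := rad k `^ kappa.

Let q0 : 0 < q. Proof. by rewrite /q /decay powR_gt0. Qed.
Let q1 : q < 1.
Proof.
have e1 : 1 `^ kappa = 1 :> R by rewrite powR1.
rewrite -e1; apply: gt0_ltr_powR; rewrite ?nnegrE //; lra.
Qed.

Let rad_gt0 k : 0 < rad k. Proof. by rewrite /rad mulr_gt0 ?exprn_gt0. Qed.
Let radS k : rad k.+1 = rad k / 2%:R.
Proof. by rewrite /rad exprSr mulrA. Qed.
Let rad_le k : rad k <= R0.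
Proof. by rewrite /rad ler_piMr ?(ltW R00) // exprn_ile1 //; lra. Qed.
Let a_ge0 k : 0 <= a k. Proof. exact: powR_ge0. Qed.
Let aS k : a k.+1 = q * a k.
Proof. by rewrite /a radS mulrC powRM ?(ltW (rad_gt0 k)). Qed.

Let M := 24%:R * W / (1 - q).
Let M0 : 0 <= M. Proof. by rewrite /M divr_ge0 ?mulr_ge0 // subr_ge0 ltW. Qed.

(** The normals at dyadic scales form a Cauchy sequence up to sign, because the angles
    between consecutive ones decay geometrically; hence the slab of each scale
    can be given the normal of any smaller scale. *)
Let dyadic_normals x : S x -> exists2 n : nat -> 'rV[R]_3,
  forall k, enorm (n k) = 1 &
  forall k j y, S y -> enorm (y - x) <= rad k ->
    `|dotp (y - x) (n (k + j)%N)| <= (W + M) * a k * rad k.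
Proof.
move=> Sx.
have [n hn] := @choice nat 'rV[R]_3 (fun k n => enorm n = 1 /\ forall y, S y ->
    enorm (y - x) <= 2%:R * rad k -> `|dotp (y - x) n| <= W * a k * rad k)
  (fun k => let: ex_intro2 n n1 hn := flat Sx (rad_gt0 k) (rad_le k) in
            ex_intro _ n (conj n1 hn)).
have n1 k : enorm (n k) = 1 by case: (hn k).
exists n => // k j y Sy yk.
have Wa i : 0 <= W * a i by rewrite mulr_ge0.
have step i : sine (n i) (n i.+1) <= 24%:R * W * a i.
  have r0 := rad_gt0 i.+1.
  apply: le_trans (@normals_close x (rad i.+1) _ _ (2%:R * W * a i * rad i.+1)
      (W * a i * rad i.+1) Sx r0 (rad_le _) (n1 i) (n1 i.+1) _ _) _.
  - move=> z Sz zr; apply: le_trans ((hn i).2 z Sz _) _.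
      by apply: le_trans zr _; rewrite radS; have := rad_gt0 i; lra.
    by rewrite radS; lra.
  - move=> z Sz zr; apply: le_trans ((hn i.+1).2 z Sz _) _.
      by apply: le_trans zr _; lra.
    rewrite ler_pM2r // aS; apply: ler_wpM2l => //.
    by rewrite ler_piMl // ltW.
  - rewrite le_eqVlt; apply/orP; left; apply/eqP; field.
    by rewrite gt_eqF.
(* The telescoping form of the geometric series. *)
have tele i : sine (n k) (n (k + i)%N) <= M * (a k - a (k + i)%N).
  elim: i => [|i IH]; first by rewrite addn0 sinenn subrr mulr0.
  rewrite addnS; apply: le_trans (sine_tri (n1 k) (n1 (k + i)%N) (n1 _)) _.
  apply: le_trans (lerD IH (step _)) _.
  have -> : 24%:R * W * a (k + i)%N = M * (a (k + i)%N - a (k + i).+1).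
    rewrite aS /M; field; move: q1; rewrite -subr_gt0 => q1'.
    by rewrite gt_eqF.
  by rewrite -mulrDr subrKA.
apply: le_trans (dotp_sine (y - x) (n1 _) (n1 k)) _.
have h1 : `|dotp (y - x) (n k)| <= W * a k * rad k.
  by apply: (hn k).2 => //; apply: le_trans yk _; have := rad_gt0 k; lra.
have h2 : sine (n (k + j)%N) (n k) * enorm (y - x) <= M * a k * rad k.
  apply: ler_pM; rewrite ?sine_ge0 ?enorm_ge0 // sineC.
  apply: le_trans (tele j) _; rewrite ler_wpM2l //.
  by have := a_ge0 (k + j)%N; lra.
lra.
Qed.

Lemma tangent_const_ge0 : 0 <= tangent_const kappa.
Proof.
rewrite /tangent_const -/q mulr_ge0 ?divr_ge0 ?(ltW q0) //.
by rewrite addr_ge0 // divr_ge0 // subr_ge0 ltW.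
Qed.

Lemma compact_unit_sphere : compact [set n : 'rV[R]_3 | enorm n = 1].
Proof.
apply: bounded_closed_compact.
  exists 1; split => // t t1 n /= n1.
  by apply: le_trans (normrV_le_enorm n) _; rewrite n1 ltW.
rewrite (_ : mkset _ = [set n | enorm n <= 1] `&` [set n | - enorm n <= - 1]).
  apply: closedI.
    apply: (@closed_lipschitz_le _ 1) => x y; rewrite mul1r.
    exact: enorm_dist_le.
  apply: (@closed_lipschitz_le _ 1) => x y; rewrite mul1r -opprD normrN.
  exact: enorm_dist_le.
apply/seteqP; split => n /=; first by move=> ->.
by move=> [h1 h2]; lra.
Qed.

(** A cluster point of the dyadic normals inherits the slab estimates of all scales,
    without any consistent choice of their signs. *)
Lemma tangent_normal x : S x -> exists2 n, enorm n = 1 &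
  forall y, S y -> enorm (y - x) <= R0 ->
    `|dotp (y - x) n| <= tangent_const kappa * W * enorm (y - x) `^ kappa * enorm (y - x).
Proof.
move=> Sx; have [n n1 hn] := dyadic_normals Sx.
have [|m [m1 cm]] := @compact_unit_sphere (n @ \oo) _.
  by exists 0%N => // k _; exact: n1.
have lim k y : S y -> enorm (y - x) <= rad k ->
    `|dotp (y - x) m| <= (W + M) * a k * rad k.
  move=> Sy yk; pose C := [set u | `|dotp (y - x) u| <= (W + M) * a k * rad k].
  have cC : closed C.
    apply: (@closed_lipschitz_le _ (enorm (y - x))) => u v.
    apply: le_trans (ler_dist_dist _ _) _; rewrite -dotpBr.
    exact: cauchy_schwarz.
  apply: cC => B /cm; apply.
  exists k => // j /= kj; rewrite /C /=.
  by have := hn k (j - k)%N y Sy yk; rewrite subnKC.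
exists m => // y Sy yR.
have [->|yx] := eqVneq y x; first by rewrite subrr dotp0l normr0 enorm0 mulr0.
set d := enorm (y - x); have d0 : 0 < d by rewrite enorm_gt0 // subr_eq0.
have ex : exists k, rad k < d.
  have : (2^-1 ^+ k : R) @[k --> \oo] --> (0 : R).
    by apply: cvg_expr; rewrite ger0_norm //; lra.
  have e0 : 0 < d / (2%:R * R0) by rewrite divr_gt0 // mulr_gt0.
  move=> /cvgrPdist_le/(_ _ e0)[k _ /(_ k (leqnn k)) /=].
  rewrite sub0r normrN ger0_norm ?exprn_ge0 // ler_pdivlMr ?mulr_gt0 // => h.
  exists k; rewrite /rad mulrC; lra.
have [k rk kmin] := ex_minnP ex.
(* [k] is the first index with radius below [d], so [d] lies between two radii. *)
case: k rk kmin => [|k] rk kmin.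
  by move: rk; rewrite /rad expr0 mulr1 ltNge yR.
have dk : d <= rad k.
  by rewrite leNgt; apply/negP => /kmin; rewrite ltnn.
apply: le_trans (lim k y Sy dk) _.
have ak : a k <= d `^ kappa / q.
  rewrite ler_pdivlMr // mulrC -aS /a ge0_ler_powR ?nnegrE ?(ltW kappa0) //.
  - exact: ltW.
  - exact: ltW.
  - exact: ltW.
have rk2 : rad k <= 2%:R * d by move: rk; rewrite radS; lra.
have WM : 0 <= W + M by rewrite addr_ge0.
have -> : tangent_const kappa * W * d `^ kappa * d =
    (W + M) * (d `^ kappa / q) * (2%:R * d).
  rewrite /tangent_const -/q /M; field.
  by rewrite gt_eqF //= subr_eq0 gt_eqF.
apply: ler_pM; rewrite ?mulr_ge0 //; first exact: ltW.
by apply: ler_wpM2l.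
Qed.

(** At the scale of the distance of [x] and [y], both tangent slabs contain the piece
    of [S] around [x]. *)
Lemma tangent_normals_close x y n m : S x -> S y -> enorm n = 1 -> enorm m = 1 ->
  enorm (x - y) <= R0 / 2%:R ->
  (forall z, S z -> enorm (z - x) <= R0 ->
    `|dotp (z - x) n| <= tangent_const kappa * W * enorm (z - x) `^ kappa * enorm (z - x)) ->
  (forall z, S z -> enorm (z - y) <= R0 ->
    `|dotp (z - y) m| <= tangent_const kappa * W * enorm (z - y) `^ kappa * enorm (z - y)) ->
  x != y -> sine n m <= angle_const kappa * W * enorm (x - y) `^ kappa.
Proof.
move=> Sx Sy n1 m1 xyR hn hm xy.
set d := enorm (x - y) in xyR *; have d0 : 0 < d by rewrite enorm_gt0 // subr_eq0.
pose T := tangent_const kappa * W.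
have T0 : 0 <= T by rewrite (mulr_ge0 tangent_const_ge0 W0).
have mono e t : 0 <= e -> e <= t -> T * e `^ kappa * e <= T * t `^ kappa * t.
  move=> e0 et; apply: ler_pM => //; first by rewrite (mulr_ge0 T0) ?powR_ge0.
  rewrite ler_wpM2l // ge0_ler_powR ?nnegrE ?(ltW kappa0) //.
  exact: le_trans et.
have q2 : (2%:R * d) `^ kappa = d `^ kappa / q.
  rewrite powRM ?(ltW d0) // mulrC /q /decay; congr (_ * _).
  by rewrite -powRN -mulN1r powRrM powR_inv1 ?invr_ge0 // invrK.
apply: le_trans (@normals_close x d n m (T * d `^ kappa * d)
   (T * (2%:R * d) `^ kappa * (2%:R * d) + T * d `^ kappa * d) Sx d0 _ n1 m1 _ _) _.
- by lra.
- move=> z Sz zd; apply: le_trans (hn z Sz _) _; first by lra.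
  by apply: mono => //; exact: enorm_ge0.
- move=> z Sz zd.
  have zy : enorm (z - y) <= 2%:R * d.
    by have := enorm_tri x z y; rewrite -/d; lra.
  have -> : z - x = (z - y) - (x - y) by rewrite opprB addrA subrK.
  rewrite dotpBl; apply: le_trans (ler_normB _ _) _; apply: lerD.
    apply: le_trans (hm z Sz _) _; first by lra.
    by apply: mono => //; exact: enorm_ge0.
  by apply: le_trans (hm x Sx _) _; rewrite -/d //; lra.
- rewrite q2 /angle_const -/q le_eqVlt; apply/orP; left; apply/eqP.
  by rewrite /T; field; rewrite !gt_eqF.
Qed.

Lemma cvg_within_enorm x (f : 'rV[R]_3 -> R) (D : set 'rV[R]_3) :
  (forall e, 0 < e -> exists2 d, 0 < d &
     forall y, D y -> enorm (y - x) < d -> `|f y| <= e) ->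
  f y @[y --> within D (nbhs x)] --> (0 : R).
Proof.
move=> h; apply/cvgrPdist_le => e e0; have [d d0 hd] := h e e0.
rewrite /prop_near1 /within /=; apply/nbhs_enormP; exists d => // y yd Dy.
by rewrite sub0r normrN; exact: hd.
Qed.

Lemma within_enorm_cvg x (f : 'rV[R]_3 -> R) (D : set 'rV[R]_3) :
  f y @[y --> within D (nbhs x)] --> (0 : R) ->
  forall e, 0 < e -> exists2 d, 0 < d &
     forall y, D y -> enorm (y - x) < d -> `|f y| <= e.
Proof.
move=> /cvgrPdist_le h e e0; have := h e e0.
rewrite /prop_near1 /within /= => /nbhs_enormP[d d0 hd]; exists d => // y Dy yd.
by have := hd y yd Dy; rewrite sub0r normrN.
Qed.

Lemma small_powR (T e : R) : 0 <= T -> 0 < e -> exists2 d, 0 < d &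
  forall t, 0 <= t -> t <= d -> T * t `^ kappa <= e.
Proof.
move=> T0 e0; have T1 : 0 < T + 1 by lra.
exists ((e / (T + 1)) `^ kappa^-1); first by rewrite powR_gt0 // divr_gt0.
move=> t t0 td.
have : t `^ kappa <= ((e / (T + 1)) `^ kappa^-1) `^ kappa.
  by rewrite ge0_ler_powR ?nnegrE ?powR_ge0 ?(ltW kappa0).
rewrite -powRrM mulVf ?gt_eqF // powRr1 ?divr_ge0 ?(ltW e0) ?(ltW T1) //.
rewrite ler_pdivlMr // => h; apply: le_trans h.
by rewrite mulrC ler_wpM2l ?powR_ge0 // lerDl.
Qed.

Lemma tangent_plane_normal x : S x -> exists n,
  [/\ enorm n = 1, has_tangent_plane S x,
      forall v, v \in tangent_plane S x <-> dotp v n = 0 &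
      forall y, S y -> enorm (y - x) <= R0 ->
        `|dotp (y - x) n| <=
          tangent_const kappa * W * enorm (y - x) `^ kappa * enorm (y - x)].
Proof.
move=> Sx; have [n n1 hn] := tangent_normal Sx.
have T0 : 0 <= tangent_const kappa * W by rewrite (mulr_ge0 tangent_const_ge0 W0).
have [P dP hP] := normal_plane n1.
have appP : approximating_plane S x P.
  split => //; apply: cvg_within_enorm => e e0.
  have [d d0 hd] := small_powR T0 e0.
  exists (Num.min d R0); first by rewrite lt_min d0.
  move=> y [Sy yx]; rewrite lt_min => /andP[yd yR].
  have y0 : 0 < enorm (y - x) by rewrite enorm_gt0 // subr_eq0; apply/eqP.
  rewrite (dist_plane_normal _ _ n1 hP) normrM normr_id normfV.
  rewrite (ger0_norm (enorm_ge0 _)) ler_pdivrMr //.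
  apply: le_trans (hn y Sy (ltW yR)) _; rewrite ler_wpM2r ?enorm_ge0 //.
  by apply: hd; [exact: enorm_ge0|exact: ltW].
have uniqP Q : approximating_plane S x Q -> P = Q.
  move=> [dQ cQ]; have [m m1 hQ] := plane_normal dQ.
  have s0 : sine n m = 0.
    apply/eqP; rewrite eq_le sine_ge0 andbT; apply/ler_addgt0Pr => e e0.
    rewrite add0r.
    have e16 : 0 < e / 16%:R by rewrite divr_gt0.
    have [d d0 hd] := small_powR T0 e16.
    have [d' d'0 hd'] := within_enorm_cvg cQ e16.
    pose r := Num.min (Num.min d (d' / 2%:R)) R0.
    have r0 : 0 < r by rewrite !lt_min d0 R00 divr_gt0.
    have rd : r <= d by rewrite /r !ge_min lexx.
    have rd' : r <= d' / 2%:R by rewrite /r !ge_min lexx orbT.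
    have rR : r <= R0 by rewrite /r ge_min lexx orbT.
    apply: le_trans (@normals_close x r n m (e / 16%:R * r) (e / 16%:R * r) Sx r0 rR
      n1 m1 _ _) _.
    - move=> y Sy yr; apply: le_trans (hn y Sy (le_trans yr rR)) _.
      apply: ler_pM => //; first by rewrite (mulr_ge0 T0) ?powR_ge0.
        exact: enorm_ge0.
      by apply: hd; [exact: enorm_ge0|exact: le_trans rd].
    - move=> y Sy yr.
      have [->|yx] := eqVneq y x.
        by rewrite subrr dotp0l normr0 mulr_ge0 // ltW.
      have y0 : 0 < enorm (y - x) by rewrite enorm_gt0 // subr_eq0.
      have := hd' y (conj Sy (elimN eqP yx)).
      rewrite (dist_plane_normal _ _ m1 hQ) normrM normr_id normfV.
      rewrite (ger0_norm (enorm_ge0 _)) ler_pdivrMr // => h.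
      apply: le_trans (h _) _; first by lra.
      by rewrite ler_wpM2l // ltW.
    - rewrite le_eqVlt; apply/orP; left; apply/eqP; field.
      by rewrite gt_eqF.
  apply/vspaceP => v; apply/idP/idP.
    by move=> /hP vn; apply/hQ; apply: (sine_eq0_dotp m1 n1 _ vn); rewrite sineC.
  by move=> /hQ vm; apply/hP; exact: (sine_eq0_dotp n1 m1 s0 vm).
have hT : has_tangent_plane S x by exists P.
exists n; split => //.
have : approximating_plane S x (tangent_plane S x).
  by apply: xgetPex; exists P.
by move=> /uniqP <-.
Qed.

End tangent_planes.

(** * The tangent planes of a surface of finite energy *)

Section hoelder_estimate.
Context {R : realType}.

(** Up to [regular_radius] the base of the power in [flatness] is at most [1], so the
    exponent [1 / (p + 8)] may be replaced by the smaller one [1 / (p + 16)]. *)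
Lemma flatness_holder_le (p E r : R) : 8%:R < p -> 0 < E -> 0 < r ->
  r <= @regular_radius R p E ->
  flatness p 2%:R^-1 E r <=
    4%:R * (energy_const p 2%:R^-1)^-1 `^ (p + 16%:R)^-1 * E `^ (p + 16%:R)^-1 *
      r `^ ((p - 8%:R) / (p + 16%:R)).
Proof.
move=> p8 E0 r0 rR.
have c0 : 0 < 2%:R^-1 :> R by rewrite invr_gt0.
have e0 : 0 < 1 / 20%:R :> R by rewrite divr_gt0.
have k0 := energy_const_gt0 p c0.
have := flatness_base_le p8 c0 e0 E0 r0 rR; rewrite /flatness.
set t := E * _ / _ => ht.
have t0 : 0 < t by rewrite /t divr_gt0 // mulr_gt0 // powR_gt0.
have t1 : t <= 1.
  apply: le_trans ht _; have one : 1 `^ (p + 8%:R) = 1 :> R by rewrite powR1.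
  rewrite -[leRHS]one; apply: ge0_ler_powR; rewrite ?nnegrE ?mulr_ge0 ?exprn_ge0 //.
    lra.
  by rewrite expr2; lra.
have pe : (p + 16%:R)^-1 <= (p + 8%:R)^-1.
  by rewrite lef_pV2 ?posrE; lra.
have h : t `^ (p + 8%:R)^-1 <= t `^ (p + 16%:R)^-1.
  by apply: ger_powR => //; rewrite t0.
have -> : 4%:R * (energy_const p 2%:R^-1)^-1 `^ (p + 16%:R)^-1 * E `^ (p + 16%:R)^-1 *
      r `^ ((p - 8%:R) / (p + 16%:R)) = t `^ (p + 16%:R)^-1 / 2%:R^-1 ^+ 2.
  rewrite /t !powRM ?mulr_ge0 ?powR_ge0 ?invr_ge0 ?(ltW E0) ?(ltW k0) //.
  by rewrite -powRrM; field.
by rewrite ler_pM2r // invr_gt0 exprn_gt0.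
Qed.

End hoelder_estimate.

Theorem theorem1p3 (R : realType) (p : R) (hp : 8%:R < p) :
  exists delta1 A : R, 0 < delta1 /\ 0 <= A /\
    forall (E : R) (S : set 'rV[R]_3),
      0 < E -> lipschitz_surface S -> (integral_menger p S <= E%:E)%E ->
      [/\ forall x, S x -> has_tangent_plane S x,
          forall x, S x ->
            plane_angle (tangent_plane S x) (tangent_plane S y)
              @[y --> within S (nbhs x)] --> (0 : R) &
          forall x y, S x -> S y ->
            enorm (x - y) <= delta1 * E `^ (- (p - 8%:R)^-1) ->
            plane_angle (tangent_plane S x) (tangent_plane S y) <=
              A * E `^ (p + 16%:R)^-1 *
                enorm (x - y) `^ ((p - 8%:R) / (p + 16%:R))].
Proof.
have c0 : 0 < 2%:R^-1 :> R by rewrite invr_gt0.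
have e0 : 0 < 1 / 20%:R :> R by rewrite divr_gt0.
pose kap := (p - 8%:R) / (p + 16%:R).
have kap0 : 0 < kap by rewrite divr_gt0; lra.
pose C := 4%:R * (energy_const p 2%:R^-1)^-1 `^ (p + 16%:R)^-1.
have C0 : 0 <= C by rewrite mulr_ge0 // powR_ge0.
have T0 : 0 <= angle_const kap.
  have t0 := tangent_const_ge0 kap0.
  apply: mulr_ge0; first exact: mulr_ge0.
  by rewrite addr_ge0 // divr_ge0 // powR_ge0.
exists (scale_const p 2%:R^-1 (1 / 20%:R) / 2%:R), (8%:R * angle_const kap * C).
split; first by rewrite divr_gt0 // scale_const_gt0.
split; first by rewrite mulr_ge0 // mulr_ge0.
move=> E S E0 [kS cS [U dU SE] lipS] energy; rewrite {}SE in kS cS lipS energy *.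
pose W := C * E `^ (p + 16%:R)^-1.
have W0 : 0 <= W by rewrite mulr_ge0 // powR_ge0.
pose R0 := regular_radius p E.
have R00 : 0 < R0 := regular_radius_gt0 p E0.
have good x r : boundary U x -> 0 < r -> r <= R0 -> flat_two_sided U x r :=
  all_scales_flat_two_sided dU cS kS lipS hp E0 energy (x := x) (r := r).
have oU : open U by case: dU.
have bp x r : boundary U x -> 0 < r -> r <= R0 ->
    big_projection 2%:R^-1 (boundary U) x r.
  by move=> Sx r0 rR; apply: flat_two_sided_projection => //; exact: good.
have flat x r : boundary U x -> 0 < r -> r <= R0 ->
    exists2 n, enorm n = 1 & forall y, boundary U y -> enorm (y - x) <= 2%:R * r ->
      `|dotp (y - x) n| <= W * r `^ kap * r.
  move=> Sx r0 rR; have [|n n1 sl] := slab_of_flat_two_sided dU hp energy Sx r0.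
    by move=> y s Sy s0 sr; apply: good => //; exact: le_trans rR.
  exists n => // y Sy yr; apply: le_trans (sl y Sy yr) _.
  by rewrite ler_wpM2r ?(ltW r0) // flatness_holder_le.
have angle x y : boundary U x -> boundary U y -> enorm (x - y) <= R0 / 2%:R ->
    0 <= plane_angle (tangent_plane (boundary U) x) (tangent_plane (boundary U) y) <=
      8%:R * (angle_const kap * W * enorm (x - y) `^ kap).
  move=> Sx Sy xyR.
  have [n [n1 _ hn tn]] := tangent_plane_normal R00 W0 kap0 bp flat Sx.
  have [m [m1 _ hm tm]] := tangent_plane_normal R00 W0 kap0 bp flat Sy.
  have [xy|xy] := eqVneq x y.
    rewrite -{}xy in hm *.
    have /andP[-> /le_trans] := plane_angle_le n1 n1 hn hn; apply.
    rewrite sinenn mulr0 subrr enorm0 powR0 ?gt_eqF //.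
    by rewrite !mulr0.
  have /andP[-> /le_trans] := plane_angle_le n1 m1 hn hm; apply.
  rewrite ler_pM2l //.
  exact: (tangent_normals_close W0 kap0 bp Sx Sy n1 m1 xyR tn tm xy).
split.
- by move=> x Sx; have [n []] := tangent_plane_normal R00 W0 kap0 bp flat Sx.
- move=> x Sx; apply: cvg_within_enorm => e e1.
  have K0 : 0 <= 8%:R * (angle_const kap * W) by rewrite mulr_ge0 // mulr_ge0.
  have [d d0 hd] := small_powR kap0 K0 e1.
  exists (Num.min d (R0 / 2%:R)); first by rewrite lt_min d0 divr_gt0.
  move=> y Sy; rewrite lt_min enormB => /andP[yd yR].
  have /andP[a0 a1] := angle x y Sx Sy (ltW yR).
  rewrite ger0_norm //; apply: le_trans a1 _; rewrite mulrA.
  by apply: hd; [exact: enorm_ge0|exact: ltW].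
- move=> x y Sx Sy xy.
  have xyR : enorm (x - y) <= R0 / 2%:R by rewrite /R0 /regular_radius mulrAC.
  have /andP[_ /le_trans] := angle x y Sx Sy xyR; apply.
  by rewrite /W !mulrA.
Qed.
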